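(* Let $k$, $t$, $n$ be positive integers with $k \geq 1$, $t \geq 2$, and $n = 3k + 2t$. Then \[ AR(n, kP_3 \cup tP_2) = \frac{1}{2}(3k + 2t - 3)(3k + 2t - 4) + 1. \]
   Context: All graphs are finite and simple. $K_n$ denotes the complete graph on $n$ vertices and $P_m$ the path on $m$ vertices (so $P_2$ is a single edge and $P_3$ is a path with three vertices and two edges). $kP_3 \cup tP_2$ denotes the vertex-disjoint union of $k$ copies of $P_3$ and $t$ copies of $P_2$; it has $3k+2t$ vertices and $2k+t$ edges. An edge-coloring of a graph is an arbitrary map assigning a color to each edge (adjacent edges may receive the same color). A subgraph of an edge-colored graph is rainbow if all its edges have pairwise distinct colors. For a graph $G$ and a positive integer $n$, the anti-Ramsey number $AR(n,G)$ is the maximum number of colors (actually used) in an edge-coloring of $K_n$ that contains no rainbow subgraph isomorphic to $G$. *)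

(* Defs.v *)
From mathcomp Require Import all_boot.
Set Implicit Arguments.
Unset Strict Implicit.
Unset Printing Implicit Defensive.

Record sgraph := SGraph {
  vertex :> finType;
  adj : rel vertex;
  adj_sym : symmetric adj;
  adj_irr : irreflexive adj }.

Definition edges (G : sgraph) : {set {set G}} :=
  [set [set p.1; p.2] | p : G * G & adj p.1 p.2].

Section Complete.
Variable n : nat.
Definition complete_adj : rel 'I_n := fun x y => x != y.
Fact complete_sym : symmetric complete_adj.
Proof. by move=> x y; rewrite /complete_adj eq_sym. Qed.
Fact complete_irr : irreflexive complete_adj.
Proof. by move=> x; rewrite /complete_adj eqxx. Qed.
Definition complete := SGraph complete_sym complete_irr.
End Complete.

Section Path.
Variable m : nat.
Definition path_adj : rel 'I_m := fun x y => (x.+1 == y :> nat) || (y.+1 == x :> nat).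
Fact path_sym : symmetric path_adj.
Proof. by move=> x y; rewrite /path_adj orbC. Qed.
Fact path_irr : irreflexive path_adj.
Proof. by move=> x; rewrite /path_adj orbb gtn_eqF. Qed.
(* [path_graph m] has m vertices, hence m - 1 edges. *)
Definition path_graph := SGraph path_sym path_irr.
End Path.

Section Copies.
Variables (k : nat) (G : sgraph).
Definition copies_adj : rel ('I_k * G) :=
  fun x y => (x.1 == y.1) && adj x.2 y.2.
Fact copies_sym : symmetric copies_adj.
Proof. by move=> x y; rewrite /copies_adj eq_sym adj_sym. Qed.
Fact copies_irr : irreflexive copies_adj.
Proof. by move=> x; rewrite /copies_adj adj_irr andbF. Qed.
Definition copies := SGraph copies_sym copies_irr.
End Copies.

Section Union.
Variables G H : sgraph.
Definition dunion_adj : rel (G + H) := fun x y =>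
  match x, y with
  | inl u, inl v => adj u v
  | inr u, inr v => adj u v
  | _, _ => false
  end.
Fact dunion_sym : symmetric dunion_adj.
Proof. by move=> [x|x] [y|y] //=; rewrite adj_sym. Qed.
Fact dunion_irr : irreflexive dunion_adj.
Proof. by move=> [x|x] /=; rewrite adj_irr. Qed.
Definition dunion := SGraph dunion_sym dunion_irr.
End Union.

Section Rainbow.
Variables (K G : sgraph) (C : eqType).

(* The subgraphs of K isomorphic to G are the images of the injective vertex
   maps f : G -> K sending edges to edges; f @: e is the image of the edge e. *)
Definition image_edges (f : {ffun G -> K}) : {set {set K}} :=
  [set f @: (e : {set G}) | e in edges G].

Definition embedding (f : {ffun G -> K}) : bool :=
  injectiveb f && (image_edges f \subset edges K).

(* A coloring is a total function on vertex sets; only its values on [edges K]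
   are ever used. *)
Definition has_rainbow (c : {set K} -> C) : bool :=
  [exists f : {ffun G -> K}, embedding f && dinjectiveb c (image_edges f)].

Definition num_colors (c : {set K} -> C) : nat :=
  size (undup [seq c e | e in edges K]).
End Rainbow.

(* A coloring of K_n uses at most #|edges K_n| colors, so a palette of that size
   suffices: [leq_AR] and [AR_attained] show that this is the maximum over
   colorings with values in an arbitrary type. *)
Definition AR (n : nat) (G : sgraph) : nat :=
  \max_(c : {ffun {set complete n} -> 'I_(#|edges (complete n)|)}
        | ~~ has_rainbow G c) num_colors c.

Lemma eq_has_rainbow (K G : sgraph) (C D : eqType)
    (c : {set K} -> C) (d : {set K} -> D) :
  {in edges K &, forall e e', (c e == c e') = (d e == d e')} ->
  has_rainbow G c = has_rainbow G d.
Proof.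
move=> cd; apply: eq_existsb => f.
case: (boolP (embedding f)) => //= /andP[_ /subsetP sub].
apply/dinjectiveP/dinjectiveP => inj x y xF yF /eqP exy; apply: inj => //; apply/eqP.
  by rewrite cd ?sub.
by rewrite -cd ?sub.
Qed.

Lemma leq_AR (n : nat) (G : sgraph) (C : eqType) (c : {set complete n} -> C) :
  ~~ has_rainbow G c -> num_colors c <= AR n G.
Proof.
move=> nr; have [E0|/set0Pn[e0 e0E]] := eqVneq (edges (complete n)) set0.
  by rewrite /num_colors /image_mem E0 enum_set0.
set s := undup [seq c e | e in edges (complete n)].
have cs e : e \in edges (complete n) -> c e \in s.
  by move=> eE; rewrite mem_undup; apply/imageP; exists e.
have ss : size s <= #|edges (complete n)|.
  by rewrite (leq_trans (size_undup _)) // size_map -cardE.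
have E_gt0 : 0 < #|edges (complete n)| by apply/card_gt0P; exists e0.
pose d := [ffun e => insubd (Ordinal E_gt0) (index (c e) s)].
have dE e : e \in edges (complete n) -> d e = index (c e) s :> nat.
  move=> eE; rewrite ffunE val_insubd (leq_trans _ ss) //.
  by rewrite index_mem cs.
have cd : {in edges (complete n) &, forall e e', (c e == c e') = (d e == d e')}.
  move=> e e' eE e'E; rewrite -val_eqE /= !dE //.
  apply/eqP/eqP => [->//|].
  exact: (index_inj (c e) (cs _ eE) (cs _ e'E)).
rewrite (eq_has_rainbow G cd) in nr.
rewrite /AR (bigD1 d) //=; apply: leq_trans (leq_maxl _ _).
rewrite /num_colors -/s.
rewrite -(size_map (fun x => index x s)).
rewrite -(size_map val (undup [seq d e | e in _])); apply: uniq_leq_size.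
  rewrite map_inj_in_uniq ?undup_uniq // => x y xs ys.
  exact: (index_inj x xs ys).
move=> _ /mapP[x + ->]; rewrite mem_undup => /imageP[e eE ->].
apply/mapP; exists (d e); last exact/esym/dE.
by rewrite mem_undup; apply/imageP; exists e.
Qed.

Lemma AR_attained (n : nat) (G : sgraph) (C : eqType) (c : {set complete n} -> C) :
  ~~ has_rainbow G c -> 0 < #|edges (complete n)| ->
  exists2 d : {ffun {set complete n} -> 'I_(#|edges (complete n)|)},
    ~~ has_rainbow G d & num_colors d = AR n G.
Proof.
move=> nr E_gt0.
pose P (d : {ffun {set complete n} -> 'I_(#|edges (complete n)|)}) :=
  ~~ has_rainbow G d.
suff P_gt0 : 0 < #|P|.
  pose F (d : {ffun {set complete n} -> 'I_(#|edges (complete n)|)}) := num_colors d.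
  by have [d dP eAR] := eq_bigmax_cond F P_gt0; exists d.
apply/card_gt0P.
exists [ffun=> Ordinal E_gt0]; rewrite unfold_in; apply: contra nr.
case/existsP=> f /andP[fe /dinjectiveP inj]; apply/existsP; exists f.
rewrite fe; apply/dinjectiveP => x y xF yF _.
by apply: inj => //; rewrite !ffunE.
Qed.

(* Main.v *)
Require Import Defs.
From mathcomp Require Import all_boot all_order all_algebra.
From mathcomp Require Import zify lra.

Set Implicit Arguments.
Unset Strict Implicit.
Unset Printing Implicit Defensive.

(** Lower bound: colour the edges inside all but three vertices with pairwise
different colours and every other edge with one more colour.  A spanning
rainbow copy could use a single edge at the three exceptional vertices, and
one edge does not cover them ([extremal_no_rainbow]).

Upper bound: the deficit of a vertex set [W] is the number of edges inside [W]
minus the number of colours on them.  One colour more than in the extremal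
colouring means deficit at most [3 n - 8], and the claim is that this forces a
rainbow copy spanning [W], for every coloured complete graph of the right size
([forces_rainbow]).  The bound falls by 3 with each vertex removed, so an edge
whose removal lowers the deficit by 6, or a two-coloured [P_3] whose removal
lowers it by 9, reduces the problem to a smaller one, provided that its colours
do not occur among the other vertices.  Call an edge exclusive if its colour
does not occur away from its ends.

The deficit is monotone and supermodular: it counts repetitions, which
accumulate faster in larger sets ([deficit_supermod]).  Hence the deficits lost
with single vertices bound the deficit lost with all of them
([deficit_setD]).  If removing an exclusive edge lowered the deficit by at most
5, and likewise for the other exclusive edges at its ends, these bounds would
add up to a total deficit below [3 n - 8] ([no_cheap]).  So if there are
exclusive edges, then one of them gives a reduction when [t >= 3]
([forces_rainbow_edge]).  When [t = 2] one removes a path through an exclusive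
edge; if no exclusive edge extends to such a path, then removing one of them
leaves a deficit of at most [n - 4], and so few repetitions leave a Hamiltonian
path without repeated colours ([forces_rainbow_path]).

If there is no exclusive edge, each colour occurs twice, which is too few
colours for the bound unless [n <= 9].  For [n = 7] and [n = 9] a double count
finds edges whose removal leaves five vertices with many colours
([ex_light_edge]), and a finite search settles five vertices ([rainbow_K5]).
An exclusive edge for [n = 7] is handled by inspecting the ten edges that join
it to the other vertices ([rainbow7_exclusive]). *)

(** * Colour deficit of a vertex set *)

Definition pairs (T : finType) (W : {set T}) : {set {set T}} :=
  [set e : {set T} | e \subset W & #|e| == 2].

Lemma ex_subset_card (T : finType) (A : {set T}) m :
  m <= #|A| -> exists2 B : {set T}, B \subset A & #|B| = m.
Proof.
move=> mA; have : 0 < #|[set B : {set T} | B \subset A & #|B| == m]|.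
  by rewrite cards_draws bin_gt0.
by case/card_gt0P => B; rewrite inE => /andP[BA /eqP Bm]; exists B.
Qed.

Section Deficit.
Variables (T C : finType) (c : {set T} -> C).
Implicit Types (W N A B : {set T}) (F G : {set {set T}}).

Definition cols W : {set C} := c @: pairs W.
Definition deficit W := 'C(#|W|, 2) - #|cols W|.

Lemma card_pairs W : #|pairs W| = 'C(#|W|, 2).
Proof. exact: cards_draws. Qed.

Lemma pairsP W e :
  reflect (exists x y, [/\ x != y, x \in W, y \in W & e = [set x; y]])
          (e \in pairs W).
Proof.
rewrite inE; apply: (iffP andP) => [[sub /cards2P[x [y [xy ee]]]]|].
  by exists x, y; split => //; apply: (subsetP sub); rewrite ee !inE eqxx ?orbT.
move=> [x [y [xy xW yW ->]]]; rewrite cards2 xy; split=> //.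
by apply/subsetP => z; rewrite !inE => /orP[]/eqP->.
Qed.

Lemma mem_pairs W x y : x != y -> x \in W -> y \in W -> [set x; y] \in pairs W.
Proof. by move=> xy xW yW; apply/pairsP; exists x, y. Qed.

Lemma mem_cols W x y : x != y -> x \in W -> y \in W -> c [set x; y] \in cols W.
Proof. by move=> xy xW yW; apply/imset_f/mem_pairs. Qed.

Lemma pairsS A B : A \subset B -> pairs A \subset pairs B.
Proof.
by move=> AB; apply/subsetP => e; rewrite !inE => /andP[/subset_trans->].
Qed.

Lemma colsS A B : A \subset B -> cols A \subset cols B.
Proof. by move=> AB; apply/imsetS/pairsS. Qed.

Lemma card_cols W : #|cols W| + deficit W = 'C(#|W|, 2).
Proof. by rewrite addnC subnK // -card_pairs leq_imset_card. Qed.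

Definition loss F := #|F| - #|c @: F|.

Lemma lossE F : #|c @: F| + loss F = #|F|.
Proof. by rewrite addnC subnK // leq_imset_card. Qed.

Lemma lossS F G : F \subset G -> loss F <= loss G.
Proof.
move=> FG; have := lossE F; have := lossE G.
have -> : #|G| = #|F| + #|G :\: F|.
  by rewrite -(cardsID F G) (setIidPr FG).
have : #|c @: G| <= #|c @: F| + #|G :\: F|.
  rewrite -{1}(setID G F) (setIidPr FG) imsetU (leq_trans (leq_card_setU _ _)) //.
  by rewrite leq_add2l leq_imset_card.
by lia.
Qed.

Lemma loss_supermod F G : loss F + loss G <= loss (F :|: G) + loss (F :&: G).
Proof.
have := lossE F; have := lossE G; have := lossE (F :|: G); have := lossE (F :&: G).
have := cardsUI F G; have := cardsUI (c @: F) (c @: G); rewrite -imsetU.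
have : #|c @: (F :&: G)| <= #|c @: F :&: c @: G|.
  by apply/subset_leq_card; rewrite subsetI !imsetS ?subsetIl ?subsetIr.
move: #|c @: (F :|: G)| #|c @: (F :&: G)| #|c @: F :&: c @: G|.
by move: #|F :|: G| #|F :&: G|; lia.
Qed.

Lemma deficitE W : deficit W = loss (pairs W).
Proof. by rewrite /deficit -card_pairs. Qed.

Lemma deficitS A B : A \subset B -> deficit A <= deficit B.
Proof. by move=> AB; rewrite !deficitE; apply/lossS/pairsS. Qed.

(** The number of colours of an edge set is submodular, since the image of an
    intersection lies in the intersection of the images.  So [loss] is
    supermodular, and the edges inside [A :|: B] include those inside [A] and
    those inside [B]. *)
Lemma deficit_supermod A B :
  deficit A + deficit B <= deficit (A :|: B) + deficit (A :&: B).
Proof.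
rewrite !deficitE; apply: leq_trans (loss_supermod _ _) _.
rewrite leq_add ?lossS //.
  by rewrite subUset !pairsS ?subsetUl ?subsetUr.
by apply/subsetP => e; rewrite !inE subsetI => /andP[/andP[-> ->] /andP[->]].
Qed.

Lemma deficit_small W : #|W| <= 2 -> deficit W = 0.
Proof.
rewrite /deficit; case: ltngtP => // [|W2 _]; first by case: #|W| => [|[|]].
suff : 0 < #|cols W| by rewrite W2 binn; lia.
have /cards2P[x [y [xy WE]]] : #|W| == 2 by rewrite W2.
by apply/card_gt0P; exists (c [set x; y]); rewrite mem_cols // WE !inE eqxx ?orbT.
Qed.

Lemma deficit_lt_bin W q : #|W| <= q -> 2 <= q -> deficit W < 'C(q, 2).
Proof.
move=> Wq q2; case: (leqP #|W| 1) => W1.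
  by rewrite deficit_small ?bin_gt0 //; lia.
have /card_gt1P[x [y [xW yW xy]]] := W1.
have : 0 < #|cols W| by apply/card_gt0P; exists (c [set x; y]); apply: mem_cols.
have := card_cols W; have : 'C(#|W|, 2) <= 'C(q, 2) by apply: leq_bin2l.
by lia.
Qed.

(** By supermodularity a vertex costs no more deficit after other vertices
    are gone than it does at first, so one-vertex bounds add up. *)
Lemma deficit_setD W N a :
  (forall v, v \in N -> deficit W <= deficit (W :\ v) + a) ->
  deficit W <= deficit (W :\: N) + a * #|N|.
Proof.
have [m] := ubnP #|N|; elim: m N => // m IH N.
have [->|[v vN]] := set_0Vmem N; first by rewrite setD0 cards0 muln0 addn0.
rewrite [in _ < _](cardsD1 v) vN => Nm Na.
have := IH (N :\ v) Nm (fun u uN => Na u (subsetP (subsetDl _ _) u uN)).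
have := Na v vN; have := deficit_supermod (W :\: (N :\ v)) (W :\ v).
have : deficit (W :\: (N :\ v) :|: W :\ v) <= deficit W.
  by rewrite deficitS // subUset !subsetDl.
have -> : (W :\: (N :\ v)) :&: (W :\ v) = W :\: N.
  apply/setP => z; rewrite !inE; case: (eqVneq z v) => [->|_] /=.
    by rewrite vN andbF.
  by case: (z \in N) (z \in W) => [] [].
have := cardsD1 v N; rewrite vN; nia.
Qed.

(** Removing all but [q] vertices of [W] costs at most [a] each, and [q]
    vertices have deficit below ['C(q, 2)] because some colour occurs there. *)
Lemma deficit_bound W N a q :
  2 <= q <= #|W| -> #|W :\: N| <= q ->
  (forall v, v \in N -> deficit W <= deficit (W :\ v) + a) ->
  deficit W < 'C(q, 2) + a * (#|W| - q).
Proof.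
move=> /andP[q2 qW] Nq Na.
have [M MN Mq] : exists2 M : {set T}, M \subset W :&: N & #|M| = #|W| - q.
  by apply: ex_subset_card; have := cardsID N W; lia.
have [MW {}MN] : M \subset W /\ M \subset N by apply/andP; rewrite -subsetI.
have := @deficit_setD W M a (fun v vM => Na v (subsetP MN v vM)).
have Dq : #|W :\: M| = q by rewrite cardsD (setIidPr MW); lia.
have : deficit (W :\: M) < 'C(q, 2) by rewrite deficit_lt_bin // Dq.
by rewrite Mq; lia.
Qed.

End Deficit.

(** * Spanning linear forests read off a vertex sequence *)

Section Forest.
Variable T : finType.
Implicit Types (x y z : T) (s : seq T) (e : {set T}) (W : {set T}).

Fixpoint matching_edges t s : seq {set T} :=
  match t, s with
  | t'.+1, x :: y :: s' => [set x; y] :: matching_edges t' s'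
  | _, _ => [::]
  end.

(** The sequence lists the [k] paths [P_3] vertex by vertex, then the [t]
    single edges. *)
Fixpoint forest_edges k t s : seq {set T} :=
  match k, s with
  | 0, _ => matching_edges t s
  | k'.+1, x :: y :: z :: s' => [set x; y] :: [set y; z] :: forest_edges k' t s'
  | _, _ => [::]
  end.

Lemma forest_edges_rcons k t s x y : size s = 3 * k + 2 * t ->
  forest_edges k t.+1 (s ++ [:: x; y]) = rcons (forest_edges k t s) [set x; y].
Proof.
elim: k s => [|k IH]; last first.
  move=> [|a [|b [|d s]]] //=; try lia.
  by move=> hs; rewrite IH //; lia.
elim: t => [|t IH] s; first by case: s => //=; lia.
move=> sz; case: s sz => [|a [|b s]]; try by rewrite /=; lia.
by move=> sz /=; rewrite -[RHS]rcons_cons; congr (_ :: _); apply: IH; move: sz => /=; lia.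
Qed.

Lemma matching_edges_pairs t s e :
  uniq s -> e \in matching_edges t s -> e \in pairs [set x in s].
Proof.
elim: t s => [|t IH] [|x [|y s]] //= /and3P[]; rewrite !in_cons negb_or.
move=> /andP[xy _] _ us /orP[/eqP->|/(IH _ us)].
  by rewrite mem_pairs // !inE eqxx ?orbT.
by apply/subsetP/pairsS/subsetP => z; rewrite !inE => ->; rewrite !orbT.
Qed.

Lemma forest_edges_pairs k t s e :
  uniq s -> e \in forest_edges k t s -> e \in pairs [set x in s].
Proof.
elim: k s => [s|k IH]; first exact: matching_edges_pairs.
move=> [|x [|y [|z s]]] //= /and4P[]; rewrite !in_cons !negb_or.
move=> /and3P[xy xz _] /andP[yz _] _ us /or3P[/eqP->|/eqP->|/(IH _ us)].
- by rewrite mem_pairs // !inE eqxx ?orbT.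
- by rewrite mem_pairs // !inE eqxx ?orbT.
by apply/subsetP/pairsS/subsetP => u; rewrite !inE => ->; rewrite !orbT.
Qed.

Lemma pairs_notin W x y : x \notin W -> [set x; y] \notin pairs W.
Proof. by move=> xW; rewrite inE subUset sub1set (negPf xW). Qed.

Lemma forest_edges_uniq k t s : uniq s -> uniq (forest_edges k t s).
Proof.
have notin A k' s' x y : uniq s' -> x \notin s' ->
    [set x; y] \notin forest_edges k' A s'.
  move=> us xs; have := @pairs_notin [set z in s'] x y; rewrite inE => /(_ xs).
  by apply: contra => /forest_edges_pairs; apply.
elim: k s => [|k IH].
  elim: t => [|t IH] [|x [|y s]] //= /and3P[xs ys us].
  rewrite IH // andbT; apply: (notin t 0) => //.
  by move: xs; rewrite inE negb_or => /andP[].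
move=> [|x [|y [|z s]]] //= /and4P[]; rewrite !inE !negb_or.
move=> /and3P[xy xz xs] /andP[yz ys] zs us.
rewrite IH // !notin // !andbT; apply/eqP => /setP/(_ x).
by rewrite !inE eqxx (negPf xy) (negPf xz).
Qed.

Lemma forest_edges_path (r : rel T) k t s e : sorted r s ->
  e \in forest_edges k t s -> exists x y, r x y /\ e = [set x; y].
Proof.
elim: k s => [|k IH].
  elim: t => [|t IH] [|x [|y s]] //= /andP[rxy ps]; rewrite inE => /orP[/eqP->|].
    by exists x, y.
  by apply: IH; apply: path_sorted ps.
move=> [|x [|y [|z s]]] //= /and3P[rxy ryz ps]; rewrite !inE.
move=> /or3P[/eqP->|/eqP->|]; [by exists x, y|by exists y, z|].
by apply: IH; apply: path_sorted ps.
Qed.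

End Forest.

Section RainbowForest.
Variables (T C : finType) (c : {set T} -> C).
Implicit Types (W : {set T}) (B : {set C}).

(** A rainbow copy of [k P_3 + t P_2] that spans [W]; the colours in [B] are
    reserved for edges added to it later. *)
Definition rainbow_off k t W B := exists s : seq T,
  [/\ uniq s, [set x in s] = W, size s = 3 * k + 2 * t &
      uniq (map c (forest_edges k t s)) /\
      {in forest_edges k t s, forall e, c e \notin B}].

Definition rainbow k t W := rainbow_off k t W set0.

Lemma rainbow_offU k t W B g :
  g \notin cols c W -> rainbow_off k t W B -> rainbow_off k t W (g |: B).
Proof.
move=> gW [s [us sW ss [uc cB]]]; exists s; split=> //; split=> // e es.
rewrite !inE negb_or cB // andbT; apply: contraNneq gW => <-.
by rewrite imset_f // -sW (forest_edges_pairs us es).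
Qed.

Lemma rainbow_offS k t W B B' :
  B' \subset B -> rainbow_off k t W B -> rainbow_off k t W B'.
Proof.
move=> BB [s [us sW ss [uc cB]]]; exists s; split=> //; split=> // e /cB.
by apply: contra => /(subsetP BB).
Qed.

Lemma rainbow_add_edge k t W B x y :
  x != y -> x \in W -> y \in W -> c [set x; y] \notin B ->
  rainbow_off k t (W :\: [set x; y]) (c [set x; y] |: B) ->
  rainbow_off k t.+1 W B.
Proof.
move=> xy xW yW xyB [s [us sW ss [uc cB]]].
have sP z : (z \in s) = (z \in W :\: [set x; y]) by rewrite -sW inE.
exists (s ++ [:: x; y]); rewrite size_cat cat_uniq us forest_edges_rcons //=.
rewrite map_rcons rcons_uniq uc; split; last split.
- by rewrite !sP !inE !eqxx (negPf xy) !orbT.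
- apply/setP => z; rewrite inE mem_cat sP !inE.
  by case: eqVneq => [->|_] //=; case: eqVneq => [->|_] //=; rewrite orbF.
- lia.
- by rewrite andbT; apply/mapP => -[e /cB]; rewrite !inE negb_or => /andP[/eqP h _] /esym.
move=> e; rewrite mem_rcons inE => /orP[/eqP->//|/cB].
by rewrite !inE negb_or => /andP[].
Qed.

Lemma rainbow_add_path k t W B x y z :
  uniq [:: x; y; z] -> [set x; y; z] \subset W ->
  c [set x; y] \notin B -> c [set y; z] \notin B ->
  c [set x; y] != c [set y; z] ->
  rainbow_off k t (W :\: [set x; y; z]) (c [set x; y] |: (c [set y; z] |: B)) ->
  rainbow_off k.+1 t W B.
Proof.
move=> /= /and3P[]; rewrite !inE !negb_or => /andP[xy xz] yz _.
move=> /subsetP sub xyB yzB cc [s [us sW ss [uc cB]]].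
have sP u : (u \in s) = (u \in W :\: [set x; y; z]) by rewrite -sW inE.
have cs e : e \in forest_edges k t s ->
  [/\ c e != c [set x; y], c e != c [set y; z] & c e \notin B].
  by move/cB; rewrite !inE !negb_or => /and3P[].
exists [:: x, y, z & s]; rewrite /= us uc !andbT; split; last split.
- by rewrite !inE !sP !inE !eqxx (negPf xy) (negPf xz) (negPf yz) !orbT.
- apply/setP => u; rewrite !inE sP !inE.
  case: (boolP (u \in [set x; y; z])) => [ux|]; last first.
    by rewrite !inE !negb_or -!andbA => /and3P[/negPf-> /negPf-> /negPf->].
  by rewrite (sub u ux); move: ux; rewrite !inE -!orbA => /or3P[] ->; rewrite ?orbT.
- lia.
- rewrite inE negb_or cc /=; apply/andP; split.
    by apply/mapP => -[e /cs[/eqP h _ _]] /esym.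
  by apply/mapP => -[e /cs[_ /eqP h _]] /esym.
by move=> e; rewrite !inE => /or3P[/eqP->|/eqP->|/cs[]].
Qed.

End RainbowForest.

(** * Few repeated colours *)

Section HamiltonianPath.
Variable T : finType.
Implicit Types (W A : {set T}) (M : {set {set T}}).

Lemma sum_card_incident W M : M \subset pairs W ->
  \sum_(v in W) #|[set e in M | v \in e]| = 2 * #|M|.
Proof.
move=> MW; transitivity (\sum_(e in M) #|e|); last first.
  rewrite mulnC -sum_nat_const; apply: eq_bigr => e /(subsetP MW).
  by rewrite inE => /andP[_ /eqP->].
transitivity (\sum_(v in W) \sum_(e in M | v \in e) 1).
  by apply: eq_bigr => v _; rewrite sum1dep_card.
rewrite (exchange_big_dep (fun e => e \in M)) /=; last by move=> v e _ /andP[].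
apply: eq_bigr => e eM; rewrite sum1dep_card; congr #|pred_of_set _|.
apply/setP => v; rewrite inE eM; have /(subsetP MW) := eM.
by rewrite inE => /andP[/subsetP eW _]; case: (boolP (v \in e)) => [/eW->|]; rewrite ?andbF.
Qed.

(** The non-edges have average degree below 2.  A vertex [v] missing one edge
    is put at whichever end of a path through the others accepts it.  If
    there is none, a vertex [v] missing no edge connects a vertex missing at
    least two to a path through all the others. *)
Lemma ham_path W M : M \subset pairs W -> #|M| + 2 <= #|W| ->
  exists s, [/\ uniq s, [set x in s] = W &
                sorted (fun x y => [set x; y] \notin M) s].
Proof.
have [m] := ubnP #|W|; elim: m W M => // m IH W M Wm MW MW2.
pose deg v := #|[set e in M | v \in e]|.
have mem_s (s : seq T) A : [set x in s] = A -> forall z, (z \in s) = (z \in A).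
  by move=> <- z; rewrite inE.
have [M0|[e0 e0M]] := set_0Vmem M.
  exists (enum W); split; [exact: enum_uniq|by apply/setP => x; rewrite inE mem_enum|].
  rewrite M0; case: (enum W) => //= x s; elim: s x => //= y s IHs x.
  by rewrite inE IHs.
have avoid A (M' := [set e in M | [disjoint e & A]]) :
    M' \subset pairs (W :\: A).
  apply/subsetP => e; rewrite !inE => /andP[/(subsetP MW)]; rewrite inE.
  by move=> /andP[eW ->]; rewrite subsetD eW => ->.
have path_avoid A s : [set x in s] = W :\: A ->
    sorted (fun x y => [set x; y] \notin [set e in M | [disjoint e & A]]) s ->
    sorted (fun x y => [set x; y] \notin M) s.
  move=> sA; apply: (@sub_in_sorted _ [in W :\: A]); last first.
    by apply/allP => x; rewrite (mem_s s _ sA).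
  move=> x y; rewrite !inE => /andP[xA _] /andP[yA _].
  rewrite negb_and => /orP[//|/negP[]].
  by rewrite disjoints_subset subUset !sub1set !inE xA yA.
have degM v A : v \in A -> #|[set e in M | [disjoint e & A]]| + deg v <= #|M|.
  move=> vA; rewrite /deg -[leqRHS](cardsID [set e : {set T} | v \in e] M) addnC.
  rewrite leq_add ?subset_leq_card //; apply/subsetP => e; rewrite !inE.
    by [].
  by move=> /andP[-> /pred0P/(_ v)/=]; rewrite vA andbT => ->.
have edge_ends x y : [set x; y] \in M -> x != y.
  by move=> /(subsetP MW); rewrite inE cards2 => /andP[_]; case: (x != y).
have [v1 v1W dv1] : exists2 v, v \in W & deg v <= 1.
  apply/exists_inP; apply: contraTT (MW2); rewrite negb_exists_in => /forall_inP h.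
  rewrite -ltnNge -(ltn_pmul2l (isT : 0 < 2)).
  suff : 2 * #|W| <= 2 * #|M| by lia.
  rewrite -(sum_card_incident MW) mulnC -sum_nat_const.
  by apply: leq_sum => v /h; rewrite -ltnNge.
have [/exists_inP[v vW /eqP dv]|] := boolP [exists (v | v \in W), deg v == 1].
  have vv : v \in [set v] by rewrite inE.
  have := degM v _ vv; rewrite dv => Mv.
  have cW := cardsD1 v W; rewrite vW in cW.
  have [||s [us sW ps]] := IH (W :\ v) _ _ (avoid [set v]); try by lia.
  have {ps} ps := path_avoid _ s sW ps.
  have sP := mem_s s _ sW.
  have vs : v \notin s by rewrite sP !inE eqxx.
  have sz : size s = #|W :\ v| by rewrite -sW cardsE; apply/esym/card_uniqP.
  case: s us sW ps sP vs sz => [|a s] us sW ps sP vs sz; first by move: sz => /=; lia.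
  have [va|va] := boolP ([set v; a] \in M); last first.
    exists (v :: a :: s); split; first by rewrite cons_uniq vs.
    - by apply/setP => z; rewrite inE in_cons sP !inE; case: eqVneq => [->|].
    - by rewrite /= va.
  exists (rcons (a :: s) v); split.
  - by rewrite rcons_uniq vs.
  - by apply/setP => z; rewrite inE mem_rcons in_cons sP !inE; case: eqVneq => [->|].
  rewrite /= rcons_path; move: ps => /= ->; apply/negP => lv.
  have : 1 < deg v; last by rewrite dv.
  apply/card_gt1P; exists [set v; a], [set last a s; v].
  rewrite !inE va lv !eqxx ?orbT; split=> //.
  have al : a != last a s.
    case: s us sz {sW sP vs lv} => [|b s] /= us; first by lia.
    by move=> _; apply: contraTneq us => ->; rewrite mem_last.
  apply: contra_neq al => /setP/(_ a); rewrite !inE eqxx orbT.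
  case/esym/orP => /eqP // av.
  by move: vs; rewrite -av inE eqxx.
rewrite negb_exists_in => /forall_inP no1.
have dv0 : deg v1 = 0 by have := no1 _ v1W; lia.
have /pairsP[w [w' [ww' wW _ e0E]]] := subsetP MW _ e0M.
have dw : 1 < deg w.
  have : 0 < deg w by apply/card_gt0P; exists e0; rewrite inE e0M e0E !inE eqxx.
  by have := no1 _ wW; lia.
have vw : v1 != w by apply: contraTneq dw => <-; rewrite dv0.
have vM z : [set v1; z] \notin M.
  apply/negP => vz; suff : 0 < deg v1 by rewrite dv0.
  by apply/card_gt0P; exists [set v1; z]; rewrite !inE vz eqxx.
have := degM w [set v1; w]; rewrite !inE eqxx orbT => /(_ isT) Mw.
have sub : [set v1; w] \subset W by rewrite subUset !sub1set v1W.
have := cardsD W [set v1; w]; rewrite (setIidPr sub) cards2 vw => cW.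
have [||s [us sW ps]] := IH (W :\: [set v1; w]) _ _ (avoid _); try by lia.
have {ps} ps := path_avoid _ s sW ps.
have sP := mem_s s _ sW.
exists [:: w, v1 & s]; split.
- by rewrite /= inE negb_or eq_sym vw !sP !inE !eqxx orbT us.
- apply/setP => z; rewrite !inE sP !inE.
  by case: eqVneq => [->|_] /=; last case: eqVneq => [->|].
rewrite /= setUC vM /=; case: s ps {us sW sP} => //= a s ->.
by rewrite vM.
Qed.

End HamiltonianPath.

Section RainbowFew.
Variables (T C : finType) (c : {set T} -> C).

Lemma ex_representatives (W : {set T}) : exists2 H : {set {set T}},
  H \subset pairs W & {in H &, injective c} /\ #|H| = #|cols c W|.
Proof.
pose pk g := odflt set0 [pick e in pairs W | c e == g].
have pkP g : g \in cols c W -> pk g \in pairs W /\ c (pk g) = g.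
  rewrite /pk; case: pickP => [e /andP[eW /eqP]|h] //=.
  by case/imsetP => e eW gE; have := h e; rewrite eW gE eqxx.
exists (pk @: cols c W); first by apply/subsetP => _ /imsetP[g /pkP[? _] ->].
split; last by rewrite card_in_imset // => g h /pkP[_ {2}<-] /pkP[_ {2}<-] ->.
by move=> _ _ /imsetP[g /pkP[_ gE] ->] /imsetP[h /pkP[_ hE] ->]; rewrite gE hE => ->.
Qed.

(** A system of representatives of the colours misses so few edges that it
    has a Hamiltonian path, which contains every spanning linear forest. *)
Lemma rainbow_few_repeats k t (W : {set T}) :
  #|W| = 3 * k + 2 * t -> deficit c W + 2 <= #|W| -> rainbow c k t W.
Proof.
move=> Wn dW; have [H HW [injH cH]] := ex_representatives W.
have [||s [us sW ps]] := @ham_path _ W (pairs W :\: H); first exact: subsetDl.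
  rewrite cardsD (setIidPr HW) card_pairs cH.
  by have := card_cols c W; lia.
exists s; split=> //; first by rewrite -Wn -sW cardsE; apply/esym/card_uniqP.
split; last by move=> e _; rewrite inE.
rewrite map_inj_in_uniq ?forest_edges_uniq //.
apply: sub_in2 injH => e es; have := forest_edges_pairs us es.
rewrite sW => eW; have [x [y []]] := forest_edges_path ps es.
by move=> + eE; rewrite -eE in_setD eW andbT negbK.
Qed.

End RainbowFew.

(** * Exclusive edges *)

Section Exclusive.
Variables (T C : finType) (c : {set T} -> C).
Implicit Types (W : {set T}).

(** An exclusive edge can be added to every rainbow forest on the other
    vertices. *)
Definition exclusive W x y := c [set x; y] \notin cols c (W :\: [set x; y]).

Lemma exclusiveC W x y : exclusive W x y = exclusive W y x.
Proof. by rewrite /exclusive setUC. Qed.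

Lemma setD2 W x y : W :\: [set x; y] = W :\ x :\ y.
Proof. by rewrite setDDl. Qed.

Lemma bin2_setD1 W x : x \in W -> 'C(#|W|, 2) = 'C(#|W :\ x|, 2) + #|W :\ x|.
Proof. by move=> xW; rewrite (cardsD1 x W) xW binS bin1 addnC. Qed.

Lemma cols_setD1 W x (A : {set C}) : cols c (W :\ x) \subset A ->
  (forall y, y \in W :\ x -> c [set x; y] \in A) -> cols c W \subset A.
Proof.
move=> /subsetP WA xA; apply/subsetP => _ /imsetP[e eW ->].
have /pairsP[y [z [yz yW zW eE]]] := eW.
have [yx|yx] := eqVneq y x.
  by rewrite eE yx; apply: xA; rewrite !inE zW -yx eq_sym yz.
have [zx|zx] := eqVneq z x.
  by rewrite eE zx setUC; apply: xA; rewrite !inE yW -zx yz.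
by apply/WA; rewrite eE mem_cols // !inE ?yx ?zx.
Qed.

Lemma card_cols_setD1 W x : x \in W -> #|cols c W| <= #|cols c (W :\ x)| + #|W :\ x|.
Proof.
move=> xW; pose A := cols c (W :\ x) :|: [set c [set x; y] | y in W :\ x].
have : cols c W \subset A.
  apply: cols_setD1 => [|y yW]; first exact: subsetUl.
  by rewrite /A in_setU (imset_f (fun y => c [set x; y]) yW) orbT.
move/subset_leq_card/leq_trans; apply; apply: leq_trans (leq_card_setU _ _) _.
by rewrite leq_add2l leq_imset_card.
Qed.

Lemma exclusive_or_not W :
  (exists x y, [/\ x != y, x \in W, y \in W & exclusive W x y]) \/
  (forall x y, x != y -> x \in W -> y \in W -> ~~ exclusive W x y).
Proof.
have [/existsP[x /existsP[y /and4P[xy xW yW exy]]]|] := boolP [exists x, exists y,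
    [&& x != y, x \in W, y \in W & exclusive W x y]].
  by left; exists x, y.
rewrite negb_exists => /forallP none; right=> x y xy xW yW.
by have := none x; rewrite negb_exists => /forallP/(_ y); rewrite xy xW yW.
Qed.

Definition nonexclusive W x := [set y in W :\ x | ~~ exclusive W x y].

(** The colour of a nonexclusive edge [xy] survives the removal of [x], so this
    edge is a repetition that the removal destroys. *)
Lemma deficit_nonexclusive W x : x \in W ->
  deficit c (W :\ x) + #|nonexclusive W x| <= deficit c W.
Proof.
move=> xW; have := card_cols c W; have := card_cols c (W :\ x).
rewrite (bin2_setD1 xW).
pose N := [set y in W :\ x | exclusive W x y].
suff : #|cols c W| <= #|cols c (W :\ x)| + #|N|.
  have := cardsID [set y | exclusive W x y] (W :\ x).
  have -> : (W :\ x) :&: [set y | exclusive W x y] = N by apply/setP=> y; rewrite !inE.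
  have -> : W :\ x :\: [set y | exclusive W x y] = nonexclusive W x.
    by apply/setP => y; rewrite !inE andbC.
  by lia.
have : cols c W \subset cols c (W :\ x) :|: [set c [set x; y] | y in N].
  apply: cols_setD1 => [|y yW]; first exact: subsetUl.
  rewrite in_setU; have [ex|] := boolP (exclusive W x y).
    by rewrite (imset_f (fun y => c [set x; y])) ?orbT // inE yW.
  rewrite negbK => /(subsetP (colsS _ _)) -> //.
  by rewrite setDS // sub1set !inE eqxx.
move/subset_leq_card/leq_trans; apply; apply: leq_trans (leq_card_setU _ _) _.
by rewrite leq_add2l leq_imset_card.
Qed.

(** The number 5 is one less than the 6 by which the admissible deficit falls
    when two vertices are removed. *)
Definition cheap W x y := [&& x \in W, y \in W, x != y, exclusive W x y &
  deficit c W <= deficit c (W :\: [set x; y]) + 5].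

Lemma cheapC W x y : cheap W x y = cheap W y x.
Proof.
by rewrite /cheap exclusiveC setUC eq_sym; case: (x \in W) (y \in W) => [] [].
Qed.

(** Let [xy] be cheap and let removing [x] cost [D].  Then [D <= 5], at most [D]
    edges at [x] are not exclusive, and a further neighbour along an exclusive
    edge costs at most [5 - D] more.  For [D = 3, 4, 5] these costs cannot add
    up to the whole deficit.  So both ends of every cheap edge cost at most 2;
    all vertices except at most two are such ends, and again the costs are too
    small. *)
Lemma no_cheap W : 8 <= #|W| -> deficit c W + 8 = 3 * #|W| ->
  (forall x y z, cheap W x y -> z \in W -> x != z -> exclusive W x z -> cheap W x z) ->
  forall x y, ~~ cheap W x y.
Proof.
move=> W8 dW cl x y; apply/negP => ch.
have low u v : cheap W u v -> deficit c W <= deficit c (W :\ u) + 2.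
  move=> chuv; have /and5P[uW vW uv _ d5] := chuv.
  have := deficit_nonexclusive uW; have := cardsD1 u W; rewrite uW.
  have := deficitS c (subsetDl W [set u]); rewrite setD2 in d5.
  have := deficitS c (subsetDl (W :\ u) [set v]).
  pose D := deficit c W - deficit c (W :\ u) => h1 h2 h3 h4.
  pose N := [set w in W :\ u | exclusive W u w].
  have NE : W :\ u :\: N = nonexclusive W u.
    by apply/setP => w; rewrite !inE; case: (w != u) (w \in W) => [] [] //=; rewrite andbT.
  have bound := @deficit_bound _ _ c (W :\ u) N (5 - D) D.
  rewrite leqNgt; apply/negP => d2.
  have {bound} : deficit c (W :\ u) < 'C(D, 2) + (5 - D) * (#|W :\ u| - D).
    apply: bound; [lia|rewrite NE; lia|move=> w; rewrite !inE => /andP[/andP[wu wW] exw]].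
    rewrite eq_sym in wu; have /and5P[_ _ _ _] := cl _ _ _ chuv wW wu exw.
    by rewrite setD2; lia.
  have DE : deficit c W = deficit c (W :\ u) + D by lia.
  (* The [D] vertices left out have deficit at most ['C(D, 2) - 1]. *)
  have [D3|[D4|D5]] : D = 3 \/ D = 4 \/ D = 5 by lia.
  - by rewrite D3 (_ : 'C(3, 2) = 3) //; lia.
  - by rewrite D4 (_ : 'C(4, 2) = 6) //; lia.
  - by rewrite D5 (_ : 'C(5, 2) = 10) //; lia.
pose A := [set u | [exists v, cheap W u v]].
have WA : #|W :\: A| <= 2.
  have /and5P[xW yW xy _ _] := ch.
  have := low _ _ ch; have := deficit_nonexclusive xW.
  suff : #|W :\: A| <= #|nonexclusive W x| by lia.
  apply/subset_leq_card/subsetP => z; rewrite !inE => /andP[zA zW].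
  have xz : z != x by apply: contraNneq zA => ->; apply/existsP; exists y.
  rewrite xz zW; apply: contra zA => /(cl _ _ _ ch zW) chz.
  by apply/existsP; exists x; rewrite cheapC chz // eq_sym.
have := @deficit_bound _ _ c W A 2 2; rewrite binn => /(_ _ WA) h.
suff : deficit c W < 1 + 2 * (#|W| - 2) by lia.
by apply: h => [|v]; [lia|rewrite inE => /existsP[w /low]].
Qed.

Lemma no_exclusive_disjoint W :
  (forall x y, x != y -> x \in W -> y \in W -> ~~ exclusive W x y) ->
  forall g, g \in cols c W ->
  exists e f, [/\ e \in pairs W, f \in pairs W, c e = g, c f = g & [disjoint e & f]].
Proof.
move=> noex _ /imsetP[e eW ->]; have /pairsP[x [y [xy xW yW eE]]] := eW.
have := noex _ _ xy xW yW; rewrite /exclusive negbK => /imsetP[f].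
rewrite inE subsetD => /andP[/andP[fW fe] f2] cf; exists e, f.
split=> //; first by rewrite inE fW.
  by rewrite -cf eE.
by rewrite disjoint_sym eE.
Qed.

Definition color_class W g := [set e in pairs W | c e == g].

Lemma mem_color_class W g e :
  (e \in color_class W g) = (e \in pairs W) && (c e == g).
Proof. by rewrite [LHS]in_set. Qed.

Lemma sum_color_class W (F : {set T} -> nat) :
  \sum_(e in pairs W) F e = \sum_(g in cols c W) \sum_(e in color_class W g) F e.
Proof.
rewrite (partition_big_imset c) /=; apply: eq_bigr => g _.
by apply: eq_bigl => e; rewrite mem_color_class.
Qed.

Lemma no_exclusive_class_gt1 W :
  (forall x y, x != y -> x \in W -> y \in W -> ~~ exclusive W x y) ->
  forall g, g \in cols c W -> 2 <= #|color_class W g|.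
Proof.
move=> noex g /(no_exclusive_disjoint noex)[e [f [eW fW ce cf ef]]].
apply/card_gt1P; exists e, f; rewrite !mem_color_class eW fW ce cf !eqxx; split=> //.
apply: contraTneq ef => ->; rewrite -setI_eq0 setIid -card_gt0.
by have := fW; rewrite inE => /andP[_ /eqP->].
Qed.

End Exclusive.

Section Merge.
Variables (T C : finType) (c : {set T} -> C).
Implicit Types (W : {set T}).

Lemma merge_cols W m : 0 < m <= #|cols c W| ->
  exists h : C -> C, #|cols (h \o c) W| = m.
Proof.
move=> /andP[m0 /ex_subset_card[A AW Am]].
have [g0 g0A] : exists g, g \in A by apply/card_gt0P; rewrite Am.
pose h g := if g \in A then g else g0; exists h.
rewrite -Am; congr #|pred_of_set _|; apply/setP => g; apply/imsetP/idP.
  by move=> [e _ ->]; rewrite /= /h; case: ifP.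
by move=> gA; have /(subsetP AW)/imsetP[e eW gE] := gA; exists e; rewrite //= /h -gE gA.
Qed.

Lemma rainbow_merge (D : finType) (h : C -> D) k t W :
  rainbow (h \o c) k t W -> rainbow c k t W.
Proof.
move=> [s [us sW ss [uc _]]]; exists s; split=> //; split; last by move=> e; rewrite inE.
by move: uc; rewrite map_comp => /map_uniq.
Qed.

End Merge.

(** * Removing an edge or a path *)

Lemma bin2_gt3 n : 3 * n < 'C(n, 2) + 8.
Proof.
case: n => [|[|[|]]] // n; elim: n => // n; rewrite [in 'C(n.+4, _)]binS bin1.
by lia.
Qed.

Lemma bin2_gt6 n : 10 <= n -> 6 * n < 'C(n, 2) + 16.
Proof.
move=> /subnK <-; elim: (n - 10) => // m; rewrite addSn binS bin1.
by lia.
Qed.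

Section Removal.
Variables (T C : finType).
Implicit Types (c : {set T} -> C) (W : {set T}).

Definition deficit_forces_rainbow k t := forall c W,
  #|W| = 3 * k + 2 * t -> deficit c W + 8 <= 3 * #|W| -> rainbow c k t W.

(** A smaller deficit is raised to the threshold by merging colours, and a
    forest that is rainbow after merging was so before.  The equality gives
    the lower bounds on the deficit that [no_cheap] contradicts. *)
Lemma forces_rainbow_exact k t :
  (forall c W, #|W| = 3 * k + 2 * t -> deficit c W + 8 = 3 * #|W| ->
     rainbow c k t W) ->
  deficit_forces_rainbow k t.
Proof.
move=> H c W Wn dW; have cW := card_cols c W; have b := bin2_gt3 #|W|.
have [|h hm] := @merge_cols _ _ c W ('C(#|W|, 2) + 8 - 3 * #|W|).
  by lia.
apply: (@rainbow_merge _ _ c _ h); apply: H => //.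
by have := card_cols (h \o c) W; rewrite hm; lia.
Qed.

(** An exclusive edge that is not cheap is removed; the rest contains a
    rainbow forest, since the deficit drops at least as fast as its bound. *)
Lemma exclusive_cheap_or_rainbow k t c W x y :
  deficit_forces_rainbow k t -> #|W| = 3 * k + 2 * t.+1 ->
  deficit c W + 8 <= 3 * #|W| ->
  x != y -> x \in W -> y \in W -> exclusive c W x y ->
  cheap c W x y \/ rainbow c k t.+1 W.
Proof.
move=> IH Wn dW xy xW yW ex.
have [ch|] := boolP (cheap c W x y); [by left|rewrite /cheap xW yW xy ex /=].
rewrite -ltnNge => d6; right.
have := cardsD W [set x; y]; rewrite (setIidPr _) ?subUset ?sub1set ?xW // cards2 xy => cW.
apply: (rainbow_add_edge xy); rewrite ?inE //.
by apply: rainbow_offU => //; apply: IH; lia.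
Qed.

Lemma forces_rainbow_edge k t c W : 8 <= #|W| ->
  deficit_forces_rainbow k t -> #|W| = 3 * k + 2 * t.+1 ->
  deficit c W + 8 = 3 * #|W| ->
  (exists x y, [/\ x != y, x \in W, y \in W & exclusive c W x y]) ->
  rainbow c k t.+1 W.
Proof.
move=> W8 IH Wn dW [x [y [xy xW yW exy]]].
have [/existsP[u /existsP[v /and5P[uv uW vW exuv nch]]]|] := boolP [exists u, exists v,
    [&& u != v, u \in W, v \in W, exclusive c W u v & ~~ cheap c W u v]].
  have dW' : deficit c W + 8 <= 3 * #|W| by rewrite dW.
  by have [ch|] := exclusive_cheap_or_rainbow IH Wn dW' uv uW vW exuv; first rewrite ch in nch.
rewrite negb_exists => /forallP nch.
have ch u v : u != v -> u \in W -> v \in W -> exclusive c W u v -> cheap c W u v.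
  move=> uv uW vW exuv; have := nch u; rewrite negb_exists => /forallP/(_ v).
  by rewrite uv uW vW exuv negbK.
suff /negP[] : ~~ cheap c W x y by apply: ch.
apply: no_cheap => // u v w /and5P[uW _ _ _ _] wW uw; exact: ch.
Qed.

(** Without exclusive edges every colour occurs at least twice. *)
Lemma no_exclusive_small c W :
  deficit c W + 8 <= 3 * #|W| ->
  (forall x y, x != y -> x \in W -> y \in W -> ~~ exclusive c W x y) ->
  #|W| <= 9.
Proof.
move=> dW noex; suff : 2 * #|cols c W| <= #|pairs W|.
  by rewrite card_pairs; have := card_cols c W; case: (leqP #|W| 9) => // /bin2_gt6; lia.
rewrite -[leqRHS]sum1_card (sum_color_class c) mulnC -sum_nat_const leq_sum // => g gW.
by rewrite sum1_card no_exclusive_class_gt1.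
Qed.

End Removal.

Section PathRemoval.
Variables (T C : finType).
Implicit Types (c : {set T} -> C) (W : {set T}).

(** For an exclusive edge [xy], neither [y - x - w] nor [x - y - w] is a
    two-coloured path whose colours do not occur among the other vertices. *)
Definition dead_end c W x y w :=
  let used := c [set x; y] |: cols c (W :\: [set x; y; w]) in
  (c [set x; w] \in used) && (c [set y; w] \in used).

Definition isolated c W x y := [forall w in W :\: [set x; y], dead_end c W x y w].

Lemma setD3 W x y w : W :\: [set x; y; w] = W :\: [set x; y] :\ w.
Proof. by rewrite setDDl. Qed.

(** The colours of both edges from [xy] to a dead end also occur elsewhere, so
    these two edges count as repetitions. *)
Lemma deficit_dead_end c W x y : x != y -> x \in W -> y \in W ->
  deficit c (W :\: [set x; y]) + 2 * #|[set w in W :\: [set x; y] | dead_end c W x y w]|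
    <= deficit c W.
Proof.
move=> xy xW yW; set W' := W :\: _; set N := [set w in W' | _].
pose L := [set w in W' | ~~ dead_end c W x y w].
pose A := (c [set x; y] |: cols c W') :|:
  ([set c [set x; w] | w in L] :|: [set c [set y; w] | w in L]).
have mA w : w \in W' -> (c [set x; w] \in A) && (c [set y; w] \in A).
  move=> wW; have [/andP[dx dy]|nd] := boolP (dead_end c W x y w).
    have sub : c [set x; y] |: cols c (W :\: [set x; y; w]) \subset A.
      by rewrite /A subsetU // setUS // colsS // setD3 subsetDl.
    by rewrite !(subsetP sub).
  have wL : w \in L by rewrite inE wW nd.
  rewrite /A !in_setU (imset_f (fun w => c [set x; w]) wL).
  by rewrite (imset_f (fun w => c [set y; w]) wL) !orbT.
have W'E z : (z \in W') = [&& z != y, z != x & z \in W].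
  by rewrite /W' !inE negb_or -andbA; case: (z != x) (z != y) => [] [].
have cW : cols c W \subset A.
  apply: (@cols_setD1 _ _ _ _ x) => [|z]; last first.
    rewrite in_setD1 => /andP[zx zW]; have [->|zy] := eqVneq z y.
      by rewrite /A !in_setU in_set1 eqxx.
    by have /mA/andP[] : z \in W' by rewrite W'E zy zx.
  apply: (@cols_setD1 _ _ _ _ y) => [|z]; last first.
    by rewrite !in_setD1 => /and3P[zy zx zW]; have /mA/andP[] : z \in W' by rewrite W'E zy zx.
  by rewrite -setD2 /A subsetU // subsetUr.
have cA : #|A| <= 1 + #|cols c W'| + 2 * #|L|.
  rewrite (leq_trans (leq_card_setU _ _)) // leq_add //.
    by rewrite (leq_trans (leq_card_setU _ _)) // cards1.
  by rewrite (leq_trans (leq_card_setU _ _)) // mul2n -addnn leq_add ?leq_imset_card.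
have NL : #|N| + #|L| = #|W'|.
  rewrite -(cardsID [set w | dead_end c W x y w] W'); congr (_ + _); apply: eq_card => w.
    by rewrite !inE.
  by rewrite !inE andbC.
have := subset_leq_card cW; have := card_cols c W; have := card_cols c W'.
have yWx : y \in W :\ x by rewrite !inE eq_sym xy.
rewrite (bin2_setD1 xW) (bin2_setD1 yWx) -setD2 -/W'.
have := cardsD1 y (W :\ x); rewrite yWx -setD2 -/W'.
by lia.
Qed.

Lemma deficit_isolated c W x y : x != y -> x \in W -> y \in W ->
  isolated c W x y -> deficit c (W :\ x) + #|W| <= deficit c W + 2.
Proof.
move=> xy xW yW /forall_inP iso.
have : cols c W \subset c [set x; y] |: cols c (W :\ x).
  apply: cols_setD1 (subsetUr _ _) _ => z; rewrite in_setD1 => /andP[zx zW].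
  have [->|zy] := eqVneq z y; first exact: setU11.
  have /iso/andP[zc _] : z \in W :\: [set x; y] by rewrite !inE negb_or zx zy.
  apply: subsetP zc; rewrite setUS // colsS // setDS //.
  by apply/subsetP => u; rewrite !inE => ->.
move/subset_leq_card/leq_trans/(_ (leq_card_setU _ _)); rewrite cards1.
have := card_cols c W; have := card_cols c (W :\ x); rewrite (bin2_setD1 xW).
have := cardsD1 x W; rewrite xW.
by lia.
Qed.

Lemma rainbow_alive_path k t c W x y w :
  deficit_forces_rainbow T C k t -> #|W| = 3 * k.+1 + 2 * t ->
  deficit c (W :\: [set x; y; w]) + 8 < deficit c W -> deficit c W + 8 = 3 * #|W| ->
  x != y -> x \in W -> y \in W -> exclusive c W x y ->
  w \in W :\: [set x; y] -> ~~ dead_end c W x y w -> rainbow c k.+1 t W.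
Proof.
move=> IH Wn d8 dW xy xW yW exy; rewrite !inE negb_or -andbA => /and3P[wx wy wW].
have key a b : [set a; b] = [set x; y] -> a != b -> a != w -> b != w ->
    c [set b; w] \notin c [set x; y] |: cols c (W :\: [set x; y; w]) ->
    rainbow c k.+1 t W.
  move=> abE ab aw bw; rewrite -abE !inE negb_or => /andP[cab cbw].
  have sub : [set x; y; w] \subset W by rewrite !subUset !sub1set xW yW.
  have cW : #|W :\: [set x; y; w]| = #|W| - 3.
    rewrite cardsD (setIidPr sub) setUC cardsU1 cards2 xy !inE negb_or.
    by rewrite wx wy.
  apply: (@rainbow_add_path _ _ _ _ _ _ _ a b w); rewrite ?inE //=.
  - by rewrite !inE negb_or ab aw bw.
  - by rewrite abE.
  - by rewrite eq_sym.
  rewrite abE in cbw *; apply: rainbow_offU.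
    by apply: contra exy; apply/subsetP/colsS; rewrite setD3 subsetDl.
  apply: rainbow_offU => //; apply: IH; rewrite cW; last first.
    by move: dW d8 Wn; clear; lia.
  by move: Wn; clear; lia.
rewrite /dead_end negb_and => /orP[] h.
  by apply: (key y x) h; rewrite ?(setUC [set y]) // eq_sym.
by apply: (key x y) h; rewrite // eq_sym.
Qed.

(** A vertex that is no dead end continues [xy] to a two-coloured path, which
    costs at most 8 unless it can be removed.  If [xy] is not cheap, it costs
    [D >= 6] itself, so each such vertex costs at most [8 - D] more.  The dead
    ends are at most [D / 2], since each costs two repetitions at [xy].  These
    costs do not add up to the whole deficit. *)
Lemma exclusive_trichotomy k t c W x y : 8 <= #|W| ->
  deficit_forces_rainbow T C k t -> #|W| = 3 * k.+1 + 2 * t ->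
  deficit c W + 8 = 3 * #|W| ->
  x != y -> x \in W -> y \in W -> exclusive c W x y ->
  [\/ cheap c W x y, isolated c W x y | rainbow c k.+1 t W].
Proof.
move=> W8 IH Wn dW xy xW yW exy.
have [iso|] := boolP (isolated c W x y); first by constructor 2.
rewrite negb_forall_in => /exists_inP[w0 w0W w0N].
have [ch|] := boolP (cheap c W x y); first by constructor 1.
rewrite /cheap xW yW xy exy /= -ltnNge => d6; constructor 3.
pose alive w := (w \in W :\: [set x; y]) && ~~ dead_end c W x y w.
have [/existsP[w /andP[/andP[wW wN] dw]]|] := boolP [exists w,
   alive w && (deficit c (W :\: [set x; y; w]) + 8 < deficit c W)].
  by apply: rainbow_alive_path wW wN.
rewrite negb_exists => /forallP small.
have {}small w : alive w -> deficit c W <= deficit c (W :\: [set x; y] :\ w) + 8.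
  by move=> aw; have := small w; rewrite aw /= -leqNgt setD3.
set W' := W :\: [set x; y] in small d6 *.
have sub : [set x; y] \subset W by rewrite subUset !sub1set xW.
have cW : #|W'| = #|W| - 2 by rewrite cardsD (setIidPr sub) cards2 xy.
have w0s : deficit c W <= deficit c (W' :\ w0) + 8 by apply: small; rewrite /alive w0W.
have := deficitS c (subsetDl W' [set w0]) => w0W'.
have := deficitS c (subsetDl W [set x; y]); rewrite -/W' => WW'.
pose N := [set w | alive w].
have := deficit_dead_end c xy xW yW; rewrite -/W'.
have -> : [set w in W' | dead_end c W x y w] = W' :\: N.
  apply/setP => w; rewrite in_set [RHS]in_setD [w \in N]in_set /alive -/W' negb_and negbK.
  by case: (w \in W'); rewrite ?andbF ?andbT.
move=> dead; have [D DE] : exists D, deficit c W = deficit c W' + D.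
  by exists (deficit c W - deficit c W'); rewrite subnKC.
(* At most [D / 2 <= q] vertices are dead ends. *)
pose q := if D == 8 then 4 else 3.
have [D6 D8] : 6 <= D /\ D <= 8 by lia.
exfalso; have : deficit c W' < 'C(q, 2) + (8 - D) * (#|W'| - q).
  have b : 2 <= q <= 4 /\ (D < 8 \/ q = 4) /\ 3 <= q by rewrite /q; case: eqP; lia.
  apply: (@deficit_bound _ _ _ _ N); [lia|lia|].
  by move=> w; rewrite inE => /small; lia.
have [DD|[DD|DD]] : D = 6 \/ D = 7 \/ D = 8 by lia.
- by rewrite /q DD (_ : 'C(_, 2) = 3) //=; lia.
- by rewrite /q DD (_ : 'C(_, 2) = 3) //=; lia.
by rewrite /q DD (_ : 'C(_, 2) = 6) //=; lia.
Qed.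

(** An exclusive edge that is isolated costs [2 (n - 2)], so the remaining
    [n - 2] vertices have deficit at most [n - 4] and a rainbow Hamiltonian
    path.  An exclusive edge that is not isolated is cheap unless a path can be
    removed, and then so are the other exclusive edges at its ends, because the
    ends of isolated edges are expensive; this contradicts [no_cheap]. *)
Lemma forces_rainbow_path k t c W : 10 <= #|W| ->
  deficit_forces_rainbow T C k t.+1 -> #|W| = 3 * k.+1 + 2 * t.+1 ->
  deficit c W + 8 = 3 * #|W| -> rainbow c k.+1 t.+1 W.
Proof.
move=> W10 IH Wn dW; have W8 : 8 <= #|W| by lia.
pose excl x y := [&& x != y, x \in W, y \in W & exclusive c W x y].
have tri x y : excl x y -> [\/ cheap c W x y, isolated c W x y | rainbow c k.+1 t.+1 W].
  by move=> /and4P[xy xW yW exy]; apply: exclusive_trichotomy.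
have [/existsP[x /existsP[y /and3P[exy nch nis]]]|] := boolP [exists x, exists y,
    [&& excl x y, ~~ cheap c W x y & ~~ isolated c W x y]].
  by case: (tri _ _ exy) => // h; rewrite h in nch nis.
rewrite negb_exists => /forallP none.
have {tri none} ch x y : excl x y -> cheap c W x y \/ isolated c W x y.
  move=> exy; have := none x; rewrite negb_exists => /forallP/(_ y).
  by rewrite exy /= negb_and !negbK => /orP[]; [left|right].
have cl x y z : cheap c W x y -> z \in W -> x != z -> exclusive c W x z -> cheap c W x z.
  move=> /and5P[xW yW xy exy d5] zW xz exz.
  have [|//|iso] := ch x z; first by rewrite /excl xz xW zW.
  have := deficit_isolated xz xW zW iso.
  have : deficit c (W :\: [set x; y]) <= deficit c (W :\ x) by rewrite setD2 deficitS ?subsetDl.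
  by lia.
have nc := no_cheap W8 dW cl.
have [[x [y [xy xW yW ex]]]|noex] := exclusive_or_not c W; last first.
  have : #|W| <= 9; last by lia.
  by apply: (@no_exclusive_small _ _ c) noex; lia.
have exy : excl x y by rewrite /excl xy xW yW.
case: (ch _ _ exy) => [h|iso]; first by have := nc x y; rewrite h.
apply: (rainbow_add_edge xy); rewrite ?inE //; apply: rainbow_offU => //.
have sub : [set x; y] \subset W by rewrite subUset !sub1set xW.
have cW : #|W :\: [set x; y]| = #|W| - 2 by rewrite cardsD (setIidPr sub) cards2 xy.
apply: rainbow_few_repeats; first by lia.
have := deficit_dead_end c xy xW yW.
have -> : [set w in W :\: [set x; y] | dead_end c W x y w] = W :\: [set x; y].
  apply/setP => w; rewrite inE; apply: andb_idr => wW; exact: (forall_inP iso).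
by lia.
Qed.

End PathRemoval.

(** * Five vertices *)

Definition edges5 : seq (nat * nat) :=
  [:: (0, 1); (0, 2); (0, 3); (0, 4); (1, 2); (1, 3); (1, 4); (2, 3); (2, 4); (3, 4)].

(** Colours are listed with the reserved colour first, so the edges occupy the
    positions 1 to 10. *)
Definition edge_pos i j := (index (minn i j, maxn i j) edges5).+1.

Definition orders5 : seq (seq nat) :=
  [seq p <- permutations (iota 0 5) | (nth 0 p 0 < nth 0 p 2) && (nth 0 p 3 < nth 0 p 4)].

Definition copy_pos (p : seq nat) : seq nat :=
  [:: edge_pos (nth 0 p 0) (nth 0 p 1); edge_pos (nth 0 p 1) (nth 0 p 2);
      edge_pos (nth 0 p 3) (nth 0 p 4)].

(** The copies of [P_3 + P_2], grouped by their last position. *)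
Definition copies5 : seq (seq (seq nat)) :=
  [seq [seq q <- map copy_pos orders5 | foldr maxn 0 q == i] | i <- iota 1 10].

Definition rainbow_at (L q : seq nat) :=
  all (fun i => i < size L) q && uniq (0 :: [seq nth 0 L i | i <- q]).

(** Label 0 is the reserved colour, counted once for its own position.  The two
    cases are those of [rainbow_K5], relaxed so that they can still be reached
    with [r] labels to come. *)
Definition rich r (L : seq nat) :=
  (count_mem 0 L <= 4) && (6 <= size (undup L) + r) ||
  (count_mem 0 L <= 1) && (4 <= size (undup L) + r).

(** Labels are extended one position at a time, up to renaming of colours: a
    new colour is labelled by the position where it appears.  The nested
    conditionals keep call-by-value evaluation from exploring the branches
    that are already settled. *)
Fixpoint search (Q : seq (seq (seq nat))) L : bool :=
  if ~~ rich (size Q) L then true else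
  if Q is q :: Q' then
    all (fun x => let L' := rcons L x in
           if has (rainbow_at L') q then true else search Q' L')
        (size L :: undup L)
  else false.

Lemma search_copies5 : search copies5 [:: 0].
Proof. by vm_compute. Qed.

Lemma size_undup_cat (L R : seq nat) : size (undup (L ++ R)) <= size (undup L) + size R.
Proof.
rewrite undup_cat size_cat leq_add ?size_undup //.
by rewrite size_filter count_size.
Qed.

(** [M] is any complete canonical labelling that extends [L]. *)
Lemma search_sound Q L M :
  L = take (size L) M -> size L + size Q = size M ->
  (forall i, i < size M -> nth 0 M i \in i :: take i M) ->
  search Q L -> rich 0 M -> has (rainbow_at M) (flatten Q).
Proof.
elim: Q L => [|q Q IH] L LM sz can /=.
  have -> : L = M by rewrite LM take_oversize // -sz addn0.
  by case: rich.
case: ifP => [|_ /andP[srch0 /allP srch] richM].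
  move=> + _; rewrite -[M in rich 0 M](cat_take_drop (size L) M) -LM /rich.
  have := size_undup_cat L (drop (size L) M); rewrite size_drop count_cat.
  move=> u /negP nr r; case: nr; move: r => /= /orP[]/andP[c0 d0]; apply/orP.
    by left; apply/andP; split; move: (sz) c0 d0 u => /=; lia.
  by right; apply/andP; split; move: (sz) c0 d0 u => /=; lia.
have sLM : size L < size M by rewrite -sz /=; lia.
set x := nth 0 M (size L).
have L'M : rcons L x = take (size L).+1 M by rewrite (take_nth 0) // -LM.
have : if has (rainbow_at (rcons L x)) q then true else search Q (rcons L x).
  have := can _ sLM; rewrite -LM -/x inE => /orP[/eqP->//|xL].
  by apply: srch; rewrite mem_undup.
rewrite has_cat; case: ifP => [/hasP[p pq /andP[/allP pL pu]] _|_ s].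
  apply/orP; left; apply/hasP; exists p => //; apply/andP; split.
    by apply/allP => i /pL; rewrite size_rcons; lia.
  move: pu; rewrite (_ : [seq nth 0 (rcons L x) i | i <- p] = [seq nth 0 M i | i <- p]) //.
  apply/eq_in_map => i /pL; rewrite size_rcons L'M => iL.
  by rewrite nth_take.
apply/orP; right; apply: (IH (rcons L x)); rewrite ?size_rcons //.
by rewrite addSnnS.
Qed.

Section K5.
Variables (T C : finType) (c : {set T} -> C).
Implicit Types (W : {set T}) (b : C).

Lemma first_occurrence b (l : seq C) i (M := [seq index x l | x <- l]) :
  i < size M -> nth 0 M i \in i :: take i M.
Proof.
rewrite size_map => il; rewrite (nth_map b) // inE -map_take.
have [xl|xl] := boolP (nth b l i \in take i l); last first.
  by rewrite -{2}(cat_take_drop i l) index_cat (negPf xl) (drop_nth b) //= eqxx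
    size_take il addn0 eqxx.
by apply/orP; right; apply: map_f.
Qed.

Lemma color_at W b x0 i j (v := nth x0 (enum W)) :
  i < 5 -> j < 5 -> i != j ->
  nth b (b :: [seq c [set v p.1; v p.2] | p <- edges5]) (edge_pos i j)
    = c [set v i; v j].
Proof.
move: i j => [|[|[|[|[|i]]]]] [|[|[|[|[|j]]]]] // _ _ _.
all: by first [exact: erefl | rewrite [in RHS]setUC; exact: erefl].
Qed.

Lemma edges5_lt p : p \in edges5 -> p.1 < p.2 < 5.
Proof. by move: p; apply/allP. Qed.

Lemma enum_edges5 W x0 (v := nth x0 (enum W)) : #|W| = 5 ->
  perm_eq [seq [set v p.1; v p.2] | p <- edges5] (enum (pairs W)).
Proof.
move=> W5; have s5 : size (enum W) = 5 by rewrite -cardE.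
have vW i : i < 5 -> v i \in W by move=> i5; rewrite -mem_enum mem_nth ?s5.
have vE i j : i < 5 -> j < 5 -> (v i == v j) = (i == j).
  by move=> i5 j5; rewrite nth_uniq ?enum_uniq ?s5.
have u : uniq [seq [set v p.1; v p.2] | p <- edges5].
  rewrite map_inj_in_uniq // => -[i j] [i' j'] /= h h' /setP eqs.
  have /andP[ij j5] := edges5_lt h; have /andP[ij' j5'] := edges5_lt h'.
  have [i5 i5'] : i < 5 /\ i' < 5 by move: ij ij' j5 j5' => /=; lia.
  have := eqs (v i); have := eqs (v j); have := eqs (v i'); have := eqs (v j').
  rewrite !inE !vE // !eqxx ?orbT /=.
  move=> _ _ /esym/orP[]/eqP e1 /esym/orP[]/eqP e2; move: ij ij';
    rewrite /= e1 e2 ?ltnn //.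
  by move=> /ltnW; rewrite leqNgt => /negPf->.
apply: uniq_perm => //; first exact: enum_uniq.
set es := map _ _ in u *; have sub : {subset es <= enum (pairs W)}.
  move=> _ /mapP[[i j] ij ->] /=; rewrite mem_enum.
  have /andP[/= ij' j5] := edges5_lt ij.
  have i5 : i < 5 := ltn_trans ij' j5.
  by rewrite mem_pairs ?vW ?vE // ltn_eqF.
have sz : size (enum (pairs W)) <= size es by rewrite -cardE card_pairs W5.
by have [_] := uniq_min_size u sub sz.
Qed.

(** Renaming each colour to the position of its first occurrence turns the
    colouring into a labelling that the search covers. *)
Lemma rainbow_K5 W b (r := #|color_class c W b|) (d := #|cols c W :\ b|) :
  #|W| = 5 -> (r <= 3) && (5 <= d) || (r == 0) && (3 <= d) ->
  rainbow_off c 1 1 W [set b].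
Proof.
move=> W5 rd; have [x0 x0W] : exists x, x \in W by apply/card_gt0P; rewrite W5.
pose v := nth x0 (enum W); have s5 : size (enum W) = 5 by rewrite -cardE.
pose l := b :: [seq c [set v p.1; v p.2] | p <- edges5].
pose M := [seq index x l | x <- l].
have pE := enum_edges5 x0 W5.
have lE : perm_eq l (b :: [seq c e | e <- enum (pairs W)]).
  by rewrite perm_cons (map_comp c (fun p : nat * nat => [set v p.1; v p.2])) perm_map.
have cM : count_mem 0 M = r.+1.
  rewrite /M count_map -[LHS]/(count (fun x => index x l == 0) l).
  transitivity (count_mem b l).
    by apply: eq_count => x /=; rewrite (eq_sym x); case: (b == x).
  rewrite (permP lE) /= eqxx add1n count_map; congr _.+1.
  rewrite -sum1_count big_enum_cond sum1dep_card; apply: eq_card => e.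
  by rewrite mem_color_class.
have dM : size (undup M) = d.+1.
  have /perm_size-> : perm_eq (undup M) [seq index x l | x <- undup l].
    apply: uniq_perm; rewrite ?undup_uniq ?map_inj_in_uniq ?undup_uniq //.
      by move=> x y; rewrite !mem_undup => xl yl; apply: (index_inj b xl yl).
    by move=> i; rewrite mem_undup; apply/mapP/mapP => -[x xl ->]; exists x;
      rewrite ?mem_undup // -mem_undup.
  rewrite size_map; have -> : size (undup l) = #|[set x in l]|.
    by rewrite cardsE -(eq_card (mem_undup l)); apply/esym/card_uniqP/undup_uniq.
  rewrite (cardsD1 b) !inE eqxx add1n; congr _.+1; apply: eq_card => g.
  rewrite in_setD1 in_set (perm_mem lE) in_cons [RHS]in_setD1; case: eqP => //= _.
  by apply/mapP/imsetP => -[e eW ->]; exists e; rewrite // ?mem_enum // -mem_enum.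
have : has (rainbow_at M) (flatten copies5).
  apply: (search_sound _ _ _ search_copies5).
  - by rewrite /= eqxx.
  - by rewrite size_map.
  - by move=> i; apply: (@first_occurrence b).
  by rewrite /rich cM dM !addn0 !ltnS leqn0.
case/hasP => q /flatten_mapP[i _]; rewrite mem_filter => /andP[_ /mapP[p + ->]].
rewrite mem_filter mem_permutations => /andP[_ pp] /andP[/allP posM].
have p5 : size p = 5 by rewrite (perm_size pp).
have up : uniq p by rewrite (perm_uniq pp).
have mp : {in p, forall i, i < 5}.
  by move=> j; rewrite (perm_mem pp) mem_iota.
pose s := map v p; have ss : size s = 5 by rewrite size_map.
have us : uniq s.
  rewrite map_inj_in_uniq // => j j' /mp j5 /mp j5'; apply: contra_eq => jj.
  by rewrite nth_uniq ?enum_uniq ?s5.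
have fE : [seq nth b l j | j <- copy_pos p] = map c (forest_edges 1 1 s).
  have colorE j j' : j \in p -> j' \in p -> j != j' ->
      nth b l (edge_pos j j') = c [set v j; v j'].
    by move=> /mp j5 /mp j5'; apply: color_at.
  rewrite /s; case: (p) p5 up colorE => [|p0 [|p1 [|p2 [|p3 [|p4 [|]]]]]] // _ + colorE.
  rewrite [uniq _]/= !inE !negb_or andbT -!andbA => up.
  change ([:: nth b l (edge_pos p0 p1); nth b l (edge_pos p1 p2);
              nth b l (edge_pos p3 p4)] =
          [:: c [set v p0; v p1]; c [set v p1; v p2]; c [set v p3; v p4]]).
  case/and5P: up => n01 _ _ _ /and5P[n12 _ _ _ /andP[_ n34]].
  by rewrite !colorE // !inE eqxx ?orbT.
move=> uM; have : uniq [seq index x l | x <- b :: map c (forest_edges 1 1 s)].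
  rewrite -fE map_cons [index b l]/= eqxx -map_comp; move: uM.
  rewrite (_ : map (nth 0 M) _ = [seq index (nth b l i) l | i <- copy_pos p]) //.
  apply/eq_in_map => j /posM; rewrite size_map => jl /=.
  by rewrite (nth_map b).
move/map_uniq; rewrite cons_uniq => /andP[bs uc].
exists s; split=> //; last first.
  split=> // e es; rewrite inE; apply: contraNneq bs => <-.
  exact: map_f.
have sW : {subset s <= W}.
  by move=> _ /mapP[j /mp j5 ->]; rewrite -mem_enum mem_nth ?s5.
apply/eqP; rewrite eqEcard; apply/andP; split.
  by apply/subsetP => x; rewrite inE => /sW.
by rewrite W5 cardsE (card_uniqP us) ss.
Qed.

End K5.

(** * Seven and nine vertices *)

Section SmallCases.
Variables (T C : finType) (c : {set T} -> C).
Implicit Types (W : {set T}).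

Lemma rainbow_seq k t W s : uniq s -> {subset s <= W} -> size s = #|W| ->
  size s = 3 * k + 2 * t -> uniq (map c (forest_edges k t s)) -> rainbow c k t W.
Proof.
move=> us sW sz skt uc; exists s; split=> //; last first.
  by split=> // e _; rewrite inE.
apply/eqP; rewrite eqEcard cardsE (card_uniqP us) sz leqnn andbT.
by apply/subsetP => x; rewrite inE => /sW.
Qed.

Lemma card_setD2 W x y : x != y -> x \in W -> y \in W -> #|W :\: [set x; y]|.+2 = #|W|.
Proof.
move=> xy xW yW; rewrite (cardsD1 x W) (cardsD1 y (W :\ x)) setD2 xW.
by rewrite !inE yW eq_sym xy.
Qed.

Lemma sum_lost (I : finType) (P : {set I}) (F : I -> {set T}) W :
  \sum_(i in P) #|cols c W :\: cols c (F i)| =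
  \sum_(g in cols c W) #|[set i in P | g \notin cols c (F i)]|.
Proof.
transitivity (\sum_(i in P) \sum_(g in cols c W | g \notin cols c (F i)) 1).
  apply: eq_bigr => i _; rewrite sum1dep_card; apply: eq_card => g.
  by rewrite in_setD in_set andbC.
rewrite (exchange_big_dep (fun g => g \in cols c W)) /=; last by move=> i g _ /andP[].
apply: eq_bigr => g gW; rewrite sum1dep_card; apply: eq_card => i.
by rewrite [LHS]in_set [RHS]in_set gW.
Qed.

(** Removing the ends of an edge [e] loses the colours all of whose edges meet
    [e].  If no edge is exclusive, every colour has two disjoint edges, so it
    is lost for at most the four edges that join these two. *)
Lemma sum_lost_edge W :
  (forall x y, x != y -> x \in W -> y \in W -> ~~ exclusive c W x y) ->
  \sum_(e in pairs W) #|cols c W :\: cols c (W :\: e)| <= 4 * #|cols c W|.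
Proof.
move=> noex; rewrite (sum_lost _ (fun e => W :\: e)).
rewrite mulnC -sum_nat_const; apply: leq_sum => g.
case/(no_exclusive_disjoint noex) => e [f [eW fW ce cf ef]].
have meets h h' : h \in pairs W -> c h = g -> g \notin cols c (W :\: h') ->
    exists2 z, z \in h & z \in h'.
  move=> hW ch gh; have /pred0Pn[z /andP[zh zh']] : ~~ [disjoint h & h'].
    apply: contra gh => hh; rewrite -ch imset_f // inE subsetD hh.
    by have := hW; rewrite inE => /andP[-> ->].
  by exists z.
have e2 : #|e| = 2 by move: eW; rewrite inE => /andP[_ /eqP].
have f2 : #|f| = 2 by move: fW; rewrite inE => /andP[_ /eqP].
suff : [set h in pairs W | g \notin cols c (W :\: h)] \subset
    [set [set u; v] | u in e, v in f].
  move/subset_leq_card/leq_trans; apply; rewrite curry_imset2X.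
  rewrite (leq_trans (leq_imset_card _ _)) ?cardsX ?e2 ?f2 //.
apply/subsetP => h; rewrite in_set => /andP[hW gh].
have [u ue uh] := meets _ _ eW ce gh; have [v vf vh] := meets _ _ fW cf gh.
have uv : u != v by apply: contraTneq vf => <-; rewrite (disjointFr ef ue).
apply/imset2P; exists u v => //; apply/eqP.
rewrite eq_sym eqEcard subUset !sub1set uh vh cards2 uv /=.
by move: hW; rewrite inE => /andP[_ /eqP->].
Qed.

Lemma sum_card_color_class W : \sum_(g in cols c W) #|color_class c W g| = #|pairs W|.
Proof.
rewrite -[RHS]sum1_card (sum_color_class c); apply: eq_bigr => g _.
by rewrite sum1_card.
Qed.

(** If every edge loses at least 3 colours or lies in a class of size at least
    [r], then 3 per edge is bounded by the lost colours, at most 4 per colour,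
    plus 3 per edge of a large class, at most [a] times the excess of the class
    sizes over 2. *)
Lemma ex_light_edge W r a :
  (forall x y, x != y -> x \in W -> y \in W -> ~~ exclusive c W x y) ->
  (forall m, 2 <= m -> r <= m -> 3 * m <= a * (m - 2)) ->
  4 * #|cols c W| + a * (#|pairs W| - 2 * #|cols c W|) < 3 * #|pairs W| ->
  exists2 e, e \in pairs W &
    #|cols c W| <= #|cols c (W :\: e)| + 2 /\ #|color_class c W (c e)| < r.
Proof.
move=> noex ra lt; have cls2 := no_exclusive_class_gt1 noex.
have [/exists_inP[e eW /andP[e1 e2]]|] := boolP [exists (e | e \in pairs W),
    (#|cols c W| <= #|cols c (W :\: e)| + 2) && (#|color_class c W (c e)| < r)].
  by exists e.
rewrite negb_exists_in => /forall_inP heavy; exfalso; move: lt.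
apply/negP; rewrite -leqNgt.
pose big g := if r <= #|color_class c W g| then 3 else 0.
apply: (@leq_trans (\sum_(e in pairs W) (#|cols c W :\: cols c (W :\: e)| + big (c e)))).
  rewrite mulnC -sum_nat_const; apply: leq_sum => e eW.
  have := heavy e eW; rewrite negb_and -leqNgt -ltnNge /big; case: ifP => [_ _|_].
    by rewrite leq_addl.
  rewrite orbF addn0 cardsD (setIidPr (colsS _ _)) ?subsetDl //.
  by move: #|_| #|_|; lia.
rewrite big_split /= leq_add ?sum_lost_edge //.
rewrite (sum_color_class c) -sum_card_color_class.
have -> : 2 * #|cols c W| = \sum_(g in cols c W) 2 by rewrite sum_nat_const mulnC.
rewrite -sumnB // big_distrr /=; apply: leq_sum => g gW.
rewrite (eq_bigr (fun=> big g)); last by move=> e; rewrite mem_color_class => /andP[_ /eqP->].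
rewrite sum_nat_const /big; case: ifP => [rg|_]; last by rewrite muln0.
by rewrite mulnC ra ?cls2.
Qed.

Lemma card_color_class_lt W (A : {set T}) g e :
  A \subset W -> e \in pairs W -> e \notin pairs A -> c e = g ->
  #|color_class c A g| < #|color_class c W g|.
Proof.
move=> AW eW eA ce; apply: proper_card; apply/properP; split.
  apply/subsetP => f; rewrite !mem_color_class => /andP[fA ->].
  by rewrite (subsetP (pairsS AW) _ fA).
by exists e; rewrite !mem_color_class ?ce ?eW ?eqxx // (negPf eA).
Qed.

Lemma card_setD1_ge (A : {set C}) g : #|A| <= #|A :\ g| + 1.
Proof. by rewrite (cardsD1 g A) addnC leq_add2l; case: (g \in A). Qed.

(** Away from a light edge there remain 5 vertices with at least 6 colours, one
    of which may be the colour of the edge, on at most 3 edges. *)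
Lemma rainbow7_no_exclusive W : #|W| = 7 -> deficit c W = 13 ->
  (forall x y, x != y -> x \in W -> y \in W -> ~~ exclusive c W x y) ->
  rainbow c 1 2 W.
Proof.
move=> W7 dW noex; have := card_cols c W; rewrite W7 (_ : 'C(7, 2) = 21) // dW => cW.
have N8 : #|cols c W| = 8 by lia.
have [||e eW [e1 e2]] := @ex_light_edge W 5 5 noex.
- by lia.
- by rewrite card_pairs W7 N8.
have /pairsP[x [y [xy xW yW eE]]] := eW; rewrite eE in eW e1 e2.
apply: (rainbow_add_edge xy); rewrite ?inE // setU0.
have := card_setD2 xy xW yW; rewrite W7 => R5.
apply: rainbow_K5; first by lia.
have := card_setD1_ge (cols c (W :\: [set x; y])) (c [set x; y]).
have : #|color_class c (W :\: [set x; y]) (c [set x; y])| < #|color_class c W (c [set x; y])|.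
  apply: (card_color_class_lt _ eW) => //; first exact: subsetDl.
  by rewrite inE subUset !sub1set !inE eqxx.
by rewrite N8 in e1; lia.
Qed.

(** Once an edge of a colour is fixed, only the removal of one of its two ends
    can lose the colour. *)
Lemma sum_lost_vertex (Q : {set T}) :
  \sum_(w in Q) #|cols c Q :\: cols c (Q :\ w)| <= 2 * #|cols c Q|.
Proof.
rewrite (sum_lost _ (fun w => Q :\ w)).
rewrite mulnC -sum_nat_const; apply: leq_sum => _ /imsetP[e eQ ->].
have /andP[eW /eqP e2] : (e \subset Q) && (#|e| == 2) by move: eQ; rewrite inE.
rewrite -e2; apply: subset_leq_card; apply/subsetP => w; rewrite in_set => /andP[wQ].
apply: contraR => we; rewrite imset_f // inE e2 eqxx subsetD eW disjoint_sym.
by rewrite disjoints1 we.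
Qed.

(** Each of the 17 colours occurs at least twice among the 36 edges, hence at
    most 4 times.  The colour of a light edge [e = uv] has only one other edge
    [xy].  Taking [x] as an end of the second removed edge [xw] destroys that
    colour among the remaining vertices, where only the colour of [xw] must then
    be avoided; [w] is chosen so that at least 6 colours remain. *)
Lemma rainbow9_no_exclusive W : #|W| = 9 -> deficit c W = 19 ->
  (forall x y, x != y -> x \in W -> y \in W -> ~~ exclusive c W x y) ->
  rainbow c 1 3 W.
Proof.
move=> W9 dW noex; have := card_cols c W; rewrite W9 (_ : 'C(9, 2) = 36) // dW => cW.
have N17 : #|cols c W| = 17 by lia.
have [||e eW [e1 e2]] := @ex_light_edge W 3 9 noex.
- by lia.
- by rewrite card_pairs W9 N17.
have gW : c e \in cols c W by exact: imset_f.
have [e' [f [e'W fW ce' cf ef]]] := no_exclusive_disjoint noex gW.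
have class2 : color_class c W (c e) = [set e'; f].
  apply/esym/eqP; rewrite eqEcard cards2 subUset !sub1set !mem_color_class e'W fW ce' cf !eqxx /=.
  suff -> : e' != f by [].
  apply: contraTneq ef => ->; rewrite -setI_eq0 setIid -card_gt0.
  by have := fW; rewrite inE => /andP[_ /eqP->].
have {gW} [u [v [x [y [[uv uW vW eE] [xy xW yW] [xe ye] clE]]]]] : exists u v x y,
   [/\ [/\ u != v, u \in W, v \in W & e = [set u; v]],
       [/\ x != y, x \in W & y \in W],
       x \notin e /\ y \notin e & color_class c W (c e) = [set e; [set x; y]]].
  have := mem_color_class c W (c e) e; rewrite class2 eW eqxx !inE.
  have /pairsP[u [v [uv uW vW eE]]] := eW.
  case/orP => /eqP ee; [have hW := fW | have hW := e'W];
    have /pairsP[x [y [xy xW yW hE]]] := hW; exists u, v, x, y.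
    split; [by []|by []| |by rewrite -ee hE].
    by rewrite ee !(disjointFl ef) ?hE ?inE ?eqxx ?orbT.
  split; [by []|by []| |by rewrite setUC -ee hE].
  by rewrite ee !(disjointFr ef) ?hE ?inE ?eqxx ?orbT.
pose W1 := W :\: [set u; v].
have W17 : #|W1| = 7 by have := card_setD2 uv uW vW; rewrite W9 => -[].
have xW1 : x \in W1 by rewrite inE -eE xe.
have yW1 : y \in W1 by rewrite inE -eE ye.
pose Q := W1 :\ x.
have Q6 : #|Q| = 6 by have := cardsD1 x W1; rewrite xW1 W17 => -[].
have yQ : y \in Q by rewrite in_setD1 eq_sym xy.
have NQ : 9 <= #|cols c Q|.
  have := card_cols_setD1 c xW1; rewrite -/Q Q6; move: e1; rewrite N17 eE -/W1.
  by clear; lia.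
have [w wQ wN] : exists2 w, w \in Q :\ y & 6 <= #|cols c (Q :\ w)|.
  apply/exists_inP; apply: contraTT (sum_lost_vertex Q).
  rewrite negb_exists_in -ltnNge => /forall_inP few.
  apply: (@leq_trans (\sum_(w in Q :\ y) (#|cols c Q| - 5))).
    have Qy : #|Q :\ y| = 5 by have := cardsD1 y Q; rewrite yQ Q6 => -[].
    rewrite sum_nat_const Qy.
    by move: NQ; clear; lia.
  rewrite (bigD1 y yQ) /= -[leqLHS]add0n leq_add //.
  rewrite [leqRHS](eq_bigl (fun w => w \in Q :\ y)); last by move=> w; rewrite in_setD1 andbC.
  apply: leq_sum => w wQ; have := few w wQ.
  rewrite -ltnNge cardsD (setIidPr (colsS _ _)) ?subsetDl //.
  by move: #|_| #|_|; clear; lia.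
pose R := Q :\ w.
have [wy wQ'] : w != y /\ w \in Q by apply/andP; rewrite -in_setD1.
have wx : w != x by move: wQ'; rewrite in_setD1 => /andP[].
have wW1 : w \in W1 by move: wQ'; rewrite in_setD1 => /andP[].
have wW : w \in W by move: wW1; rewrite in_setD => /andP[].
have we : w \notin e by move: wW1; rewrite in_setD eE => /andP[].
have RE : R = W1 :\: [set x; w] by rewrite setD2.
have R5 : #|R| = 5 by have := cardsD1 w Q; rewrite wQ' Q6 => -[].
pose b := c [set x; w].
have xwW : [set x; w] \in pairs W by rewrite mem_pairs // eq_sym.
have RW : R \subset W by rewrite /R /Q /W1 !(subset_trans (subsetDl _ _)).
have ba : b != c e.
  apply/eqP => ba; have : [set x; w] \in color_class c W (c e).
    by rewrite mem_color_class xwW -ba eqxx.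
  rewrite clE !inE => /orP[]/eqP/setP E.
    by have := E x; rewrite !inE eqxx (negPf xe).
  by have := E w; rewrite !inE eqxx orbT (negPf wx) (negPf wy).
have aR : c e \notin cols c R.
  apply/imsetP => -[h hR ch]; have : h \in color_class c W (c e).
    by rewrite mem_color_class (subsetP (pairsS RW)) // ch eqxx.
  rewrite clE !inE => /orP[]/eqP hE; move: hR; rewrite hE inE => /andP[/subsetP sub _].
    have := sub u; rewrite eE !inE eqxx => /(_ isT).
    by rewrite !andbF.
  by have := sub x; rewrite !inE !eqxx => /(_ isT); rewrite andbF.
have bR : #|color_class c R b| < #|color_class c W b|.
  apply: (card_color_class_lt RW xwW) => //.
  by rewrite inE RE subUset !sub1set !inE eqxx.
have b4 : #|color_class c W b| <= 4.
  have bW : b \in cols c W by exact: imset_f.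
  have := sum_card_color_class W; rewrite card_pairs W9 (bigD1 b bW) /=.
  have : \sum_(g in cols c W | g != b) 2 <=
      \sum_(g in cols c W | g != b) #|color_class c W g|.
    by apply: leq_sum => g /andP[gW _]; apply: no_exclusive_class_gt1.
  have -> : \sum_(g in cols c W | g != b) 2 = 32.
    rewrite (eq_bigl (fun g => g \in cols c W :\ b)).
      rewrite sum_nat_const; have := cardsD1 b (cols c W); rewrite bW N17.
      by move: #|_ :\ b|; clear; lia.
    by move=> g; rewrite in_setD1 andbC.
  by rewrite (_ : 'C(9, 2) = 36) //; move: (\sum_(_ in _ | _) _) #|_|; clear; lia.
have : rainbow_off c 1 1 R [set b].
  apply: rainbow_K5 => //; have := card_setD1_ge (cols c R) b.
  by move: wN bR b4; rewrite -/R; clear; lia.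
move/(rainbow_offU aR) => rR.
have : rainbow_off c 1 2 W1 [set c e].
  apply: (@rainbow_add_edge _ _ _ _ _ _ _ x w) => //; rewrite ?inE // ?(eq_sym x) //.
  by rewrite -RE setUC.
by rewrite eE => r1; apply: (rainbow_add_edge uv); rewrite ?inE // setU0.
Qed.

End SmallCases.

Section SevenExclusive.
Variables (T C : finType).
Implicit Types (c : {set T} -> C) (W : {set T}).

Lemma rainbow_K5_three c W : #|W| = 5 -> 3 <= #|cols c W| -> rainbow c 1 1 W.
Proof.
move=> W5 c3; apply: (@rainbow_merge _ _ c _ Some).
have cE : cols (Some \o c) W = Some @: cols c W by rewrite /cols -imset_comp.
apply: (@rainbow_offS _ _ _ _ _ _ [set None]); first exact: sub0set.
apply: rainbow_K5 => //; apply/orP; right; apply/andP; split.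
  rewrite cards_eq0; apply/eqP/setP => e; rewrite mem_color_class in_set0.
  by rewrite andbF.
rewrite cE; suff -> : Some @: cols c W :\ None = Some @: cols c W.
  by rewrite card_imset //; apply: Some_inj.
by apply/setDidPl; rewrite disjoint_sym disjoints1; apply/imsetP => -[].
Qed.

(** The copy consists of the path [a - x - b], the edge [yd] and the edge on the
    two other vertices. *)
Lemma rainbow7_copy c W x y a b d (R := W :\: [set x; y]) :
  #|W| = 7 -> x != y -> x \in W -> y \in W ->
  uniq [:: a; b; d] -> {subset [:: a; b; d] <= R} ->
  uniq [:: c [set x; a]; c [set x; b]; c [set y; d]] ->
  c [set x; a] \notin cols c R -> c [set x; b] \notin cols c R ->
  (forall p q, p != q -> p \in R :\: [set a; b; d] -> q \in R :\: [set a; b; d] ->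
     c [set y; d] != c [set p; q]) ->
  rainbow c 1 2 W.
Proof.
move=> W7 xy xW yW uabd sub ucol na nb nd.
have R5 : #|R| = 5 by have := card_setD2 xy xW yW; rewrite W7 => -[].
have P2 : #|R :\: [set a; b; d]| == 2.
  have abdR : [set a; b; d] \subset R.
    by rewrite !subUset !sub1set !sub ?inE ?eqxx ?orbT.
  rewrite cardsD (setIidPr abdR) R5 setUC cardsU1 cards2 !inE.
  move: uabd; rewrite /= !inE negb_or => /and3P[/andP[ab ad] bd _].
  by rewrite ab negb_or (eq_sym d a) ad (eq_sym d b) bd.
have /cards2P[p [q [pq PE]]] := P2.
have pP : p \in R :\: [set a; b; d] by rewrite PE !inE eqxx.
have qP : q \in R :\: [set a; b; d] by rewrite PE !inE eqxx orbT.
have RW z : z \in R -> [/\ z \in W, z != x & z != y].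
  by rewrite !inE negb_or => /andP[/andP[-> ->] ->].
have [pR qR] : p \in R /\ q \in R.
  by move: pP qP; rewrite in_setD => /andP[_ ->]; rewrite in_setD => /andP[_ ->].
have pqR := mem_cols c pq pR qR.
have [aW ax ay] := RW a (sub a (mem_head _ _)).
have [bW bx by_] : [/\ b \in W, b != x & b != y] by apply/RW/sub; rewrite !inE eqxx orbT.
have [dW dx dy] : [/\ d \in W, d != x & d != y] by apply/RW/sub; rewrite !inE eqxx !orbT.
have [pW px py] := RW p pR; have [qW qx qy] := RW q qR.
have npq z g : z \in R :\: [set a; b; d] -> g \in [set a; b; d] -> (g == z) = false.
  by move=> zP gP; apply: contraTF zP => /eqP<-; rewrite in_setD gP.
apply: (@rainbow_seq _ _ _ _ _ _ [:: a; x; b; y; d; p; q]) => //.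
- move: uabd; rewrite /= !inE !negb_or => /and3P[/andP[ab ad] bd _].
  rewrite xy !(eq_sym x) !(eq_sym y) ab ad bd ax ay by_ pq bx dx dy px qx py qy.
  by rewrite !npq // !inE eqxx ?orbT.
- by apply/allP; rewrite /= aW xW bW yW dW pW qW.
move: ucol; rewrite /= (setUC [set a]) !inE !negb_or => /and3P[/andP[-> ->] -> _].
rewrite (nd p q) // !andbT /=.
by apply/andP; split; [apply: contraNneq na|apply: contraNneq nb] => ->.
Qed.

(** The set [G] of colours that occur only at [xy], not counting that of [xy]
    itself, has at least 5 elements, on edges from [x] or [y] to [R].  If both
    [x] and [y] have such edges, two from [x] and one from [y] can be chosen with
    distinct ends.  Otherwise the five edges from [x] have different colours in
    [G], and there is a choice of the edge from [y] and of the edge inside [R],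
    since [R] is not monochromatic. *)
Lemma rainbow7_exclusive_wlog c W x y (R := W :\: [set x; y])
    (G := cols c W :\: (c [set x; y] |: cols c R)) :
  #|W| = 7 -> #|cols c W| = 8 -> x != y -> x \in W -> y \in W ->
  #|cols c R| <= 2 ->
  #|G :&: [set c [set y; w] | w in R]| <= #|G :&: [set c [set x; w] | w in R]| ->
  rainbow c 1 2 W.
Proof.
move=> W7 W8 xy xW yW R2.
have R5 : #|R| = 5 by have := card_setD2 xy xW yW; rewrite W7 => -[].
set Gx := G :&: [set c [set x; w] | w in R]; set Gy := G :&: _ => leGyx.
have GR g : g \in G -> g \notin cols c R.
  by rewrite in_setD in_setU negb_or => /andP[/andP[]].
have inG : G \subset Gx :|: Gy.
  have sub : cols c W \subset
      (c [set x; y] |: cols c R) :|: ([set c [set x; w] | w in R] :|: [set c [set y; w] | w in R]).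
    apply: (@cols_setD1 _ _ _ _ x) => [|z].
      apply: (@cols_setD1 _ _ _ _ y) => [|z].
        by rewrite -setD2 subsetU // subsetUr.
      rewrite -setD2 => zR; apply/setUP; right; apply/setUP; right.
      by apply/imsetP; exists z.
    rewrite in_setD1 => /andP[zx zW]; have [->|zy] := eqVneq z y.
      by rewrite !in_setU in_set1 eqxx.
    apply/setUP; right; apply/setUP; left; apply/imsetP; exists z => //.
    by rewrite !inE negb_or zx zy.
  apply/subsetP => g gG; have := gG; rewrite in_setD => /andP[gn /(subsetP sub)].
  by case/setUP => [h|]; [rewrite h in gn|rewrite !in_setU !in_setI gG].
have G5 : 8 <= 1 + #|cols c R| + #|G|.
  have := cardsID (c [set x; y] |: cols c R) (cols c W); rewrite W8 -/G.
  have := subset_leq_card (subsetIr (cols c W) (c [set x; y] |: cols c R)).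
  have := (leq_card_setU [set c [set x; y]] (cols c R)).1; rewrite cards1.
  by move: #|_ :&: _| #|_ |: _| #|G| #|cols c R|; clear; lia.
have GU := leq_trans (subset_leq_card inG) (leq_card_setU _ _).
have Gxle : #|Gx| <= 5.
  rewrite -R5; apply: leq_trans (leq_imset_card (fun w => c [set x; w]) R).
  exact/subset_leq_card/subsetIr.
have GxP g : g \in Gx -> exists2 w, w \in R & g = c [set x; w].
  by rewrite in_setI => /andP[_ /imsetP].
have GxR g : g \in Gx -> g \notin cols c R.
  by rewrite in_setI => /andP[/GR].
have [Gy0|[g0 g0y]] := set_0Vmem Gy.
  have Gx5 : #|Gx| = 5.
    by move: GU G5; rewrite Gy0 cards0; move: R2 Gxle; clear; lia.
  have GxE : Gx = [set c [set x; w] | w in R].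
    apply/eqP; rewrite eqEcard subsetIr Gx5 -R5; exact: leq_imset_card.
  have injx : {in R &, injective (fun w => c [set x; w])}.
    by apply/imset_injP; rewrite -GxE Gx5 R5.
  have xG w : w \in R -> c [set x; w] \in Gx.
    by move=> wR; rewrite GxE; apply/imsetP; exists w.
  have yG w : w \in R -> c [set y; w] \notin Gx.
    move=> wR; apply/negP => /setIP[gG _].
    by have /setP/(_ (c [set y; w])) := Gy0; rewrite in_set0 in_setI gG imset_f.
  have : 1 < #|cols c R|.
    move: GU G5; rewrite Gy0 cards0 Gx5; clear; lia.
  case/card_gt1P => _ [_ [/imsetP[e eR ->] /imsetP[f fR ->] cef]].
  have [z zR zef] : exists2 z, z \in R & z \notin e :|: f.
    apply/subsetPn; apply: contraTN (isT : 4 < 5) => /subset_leq_card.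
    rewrite R5 => h; rewrite -leqNgt; apply: leq_trans h _.
    apply: leq_trans (leq_card_setU _ _) _.
    by move: eR fR; rewrite !inE => /andP[_ /eqP->] /andP[_ /eqP->].
  have [h hR [zh ch]] : exists2 h, h \in pairs R & z \notin h /\ c [set y; z] != c h.
    move: zef; rewrite in_setU negb_or => /andP[ze zf].
    have [E|] := eqVneq (c [set y; z]) (c e); last by exists e.
    by exists f; rewrite // E.
  have D2 : #|R :\: (z |: h)| == 2.
    have zhR : z |: h \subset R.
      by rewrite subUset sub1set zR; move: hR; rewrite inE => /andP[].
    rewrite cardsD (setIidPr zhR) R5 cardsU1 zh.
    by move: hR; rewrite inE => /andP[_ /eqP->].
  have /cards2P[a [b [ab abE]]] := D2.
  have aD : a \in R :\: (z |: h) by rewrite abE !inE eqxx.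
  have bD : b \in R :\: (z |: h) by rewrite abE !inE eqxx orbT.
  have := aD; rewrite in_setD in_setU1 negb_or => /andP[/andP[az ah] aR].
  have := bD; rewrite in_setD in_setU1 negb_or => /andP[/andP[bz bh] bR].
  apply: (@rainbow7_copy c W x y a b z) => //.
  - by rewrite /= !inE negb_or ab az bz.
  - by apply/allP; rewrite /= -/R aR bR zR.
  - rewrite /= !inE negb_or; apply/and3P; split=> //; first apply/andP; first split.
    + by apply: contra_neq ab => /injx; apply.
    + by apply: contraNneq (yG z zR) => <-; apply: xG.
    by apply: contraNneq (yG z zR) => <-; apply: xG.
  - exact/GxR/xG.
  - exact/GxR/xG.
  move=> p q pq pP qP; suff -> : [set p; q] = h by [].
  apply/eqP; rewrite eqEcard cards2 pq subUset !sub1set.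
  move: hR; rewrite [h \in _]inE => /andP[_ /eqP->]; rewrite leqnn andbT.
  have inh u : u \in R :\: [set a; b; z] -> u \in h.
    case/setDP => uR; rewrite !inE !negb_or -!andbA => /and3P[ua ub uz].
    apply: contraTT (isT) => uh; have : u \in R :\: (z |: h).
      by rewrite in_setD uR in_setU1 negb_or uz uh.
    by rewrite abE !inE (negPf ua) (negPf ub).
  by rewrite !inh.
have [g gy gx] : exists2 g, g \in Gy & 3 <= #|Gx :\ g|.
  have [G4|G3] := leqP 4 #|Gx|.
    by exists g0 => //; have := card_setD1_ge Gx g0; move: G4; clear; lia.
  have [g /setDP[gy gnx]] : exists g, g \in Gy :\: Gx.
    apply/set0Pn; apply: contraTneq (G3) => /eqP; rewrite setD_eq0 => GyGx.
    have := subset_leq_card inG; rewrite (setUidPl GyGx).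
    by move: G5 R2; clear; lia.
  exists g => //; rewrite (setDidPl _); first by move: GU G5 R2 leGyx; clear; lia.
  by rewrite disjoint_sym disjoints1.
have [d dR gE] : exists2 d, d \in R & g = c [set y; d].
  by move: gy; rewrite in_setI => /andP[_ /imsetP].
have gR : g \notin cols c R by move: gy; rewrite in_setI => /andP[/GR].
have /card_gt1P[g1 [g2 [g1D g2D g12]]] : 1 < #|Gx :\ g :\ c [set x; d]|.
  by have := card_setD1_ge (Gx :\ g) (c [set x; d]); move: gx; clear; lia.
have := g1D; rewrite !in_setD1 => /and3P[g1d g1g g1x].
have := g2D; rewrite !in_setD1 => /and3P[g2d g2g g2x].
have [a aR g1E] := GxP _ g1x; have [b bR g2E] := GxP _ g2x.
have ad : a != d by apply: contra_neq g1d => <-.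
have bd : b != d by apply: contra_neq g2d => <-.
have ab : a != b by apply: contra_neq g12 => ab; rewrite g1E g2E ab.
apply: (@rainbow7_copy c W x y a b d) => //; rewrite -?g1E -?g2E -?gE.
- by rewrite /= !inE negb_or ab ad bd.
- by apply/allP; rewrite /= -/R aR bR dR.
- by rewrite /= !inE negb_or g12 g1g g2g.
- exact: GxR.
- exact: GxR.
move=> p q pq pP qP; apply: contraNneq gR => ->; apply: mem_cols => //.
  by move: pP; rewrite in_setD => /andP[].
by move: qP; rewrite in_setD => /andP[].
Qed.

Lemma rainbow7_exclusive c W x y : #|W| = 7 -> deficit c W = 13 ->
  x != y -> x \in W -> y \in W -> exclusive c W x y -> rainbow c 1 2 W.
Proof.
move=> W7 dW xy xW yW exy; have := card_cols c W; rewrite W7 (_ : 'C(7, 2) = 21) // dW => cW.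
have N8 : #|cols c W| = 8 by lia.
have R5 : #|W :\: [set x; y]| = 5 by have := card_setD2 xy xW yW; rewrite W7 => -[].
have [c3|c2] := leqP 3 #|cols c (W :\: [set x; y])|.
  apply: (rainbow_add_edge xy); rewrite ?inE //; apply: rainbow_offU => //.
  exact: rainbow_K5_three.
have := leq_total #|(cols c W :\: (c [set x; y] |: cols c (W :\: [set x; y]))) :&:
                     [set c [set y; w] | w in W :\: [set x; y]]|
  #|(cols c W :\: (c [set x; y] |: cols c (W :\: [set x; y]))) :&:
                     [set c [set x; w] | w in W :\: [set x; y]]|.
case/orP; first exact: rainbow7_exclusive_wlog.
by rewrite [[set x; y]]setUC; apply: rainbow7_exclusive_wlog; rewrite // 1?eq_sym // setUC.
Qed.

End SevenExclusive.

(** * Induction on the forest *)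

Section Main.
Variables (T C : finType).

Lemma forces_rainbow_large k t : 9 < 3 * k + 2 * t.+1 ->
  deficit_forces_rainbow T C k t -> deficit_forces_rainbow T C k t.+1.
Proof.
move=> n9 IH; apply: forces_rainbow_exact => c W Wn dW.
have [ex|noex] := exclusive_or_not c W.
  by apply: (forces_rainbow_edge _ IH) => //; lia.
have : #|W| <= 9; last by lia.
by apply: (@no_exclusive_small _ _ c) noex; lia.
Qed.

Lemma forces_rainbow_1_2 : deficit_forces_rainbow T C 1 2.
Proof.
apply: forces_rainbow_exact => c W W7 dW.
have dW13 : deficit c W = 13 by lia.
have [[x [y [xy xW yW exy]]]|noex] := exclusive_or_not c W.
  exact: rainbow7_exclusive exy.
exact: rainbow7_no_exclusive.
Qed.

Lemma forces_rainbow_1_3 : deficit_forces_rainbow T C 1 3.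
Proof.
apply: forces_rainbow_exact => c W W9 dW.
have [ex|noex] := exclusive_or_not c W.
  by apply: (forces_rainbow_edge _ forces_rainbow_1_2) => //; rewrite W9.
by apply: rainbow9_no_exclusive => //; lia.
Qed.

Lemma forces_rainbow k t : 1 <= k -> 2 <= t -> deficit_forces_rainbow T C k t.
Proof.
case: k => // k _; elim: k t => [|k IHk] [|[|t]] // _.
  elim: t => [|[|t] IHt]; [exact: forces_rainbow_1_2|exact: forces_rainbow_1_3|].
  by apply: forces_rainbow_large => //; lia.
elim: t => [|t IHt]; last by apply: forces_rainbow_large => //; lia.
apply: forces_rainbow_exact => c W Wn dW.
by apply: forces_rainbow_path => //; [lia|apply: IHk].
Qed.

End Main.

(** * Copies of the forest in the complete graph *)

Local Notation linear_forest k t :=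
  (dunion (copies k (path_graph 3)) (copies t (path_graph 2))) (only parsing).

Lemma edges_complete n : edges (complete n) = pairs [set: 'I_n].
Proof.
apply/setP => e; apply/imsetP/pairsP => [[[x y] xy ->]|[x [y [xy _ _ ->]]]].
  by exists x, y; rewrite !inE; split=> //; move: xy; rewrite inE.
by exists (x, y); rewrite // inE.
Qed.

Section ForestCopies.
Variables k t : nat.

Definition forest_pos (u : linear_forest k t) : nat :=
  match u with
  | inl (i, j) => 3 * i + j
  | inr (i, j) => 3 * k + 2 * i + j
  end.

Lemma forest_pos_lt u : forest_pos u < 3 * k + 2 * t.
Proof. by case: u => [[[i ik] [j j3]]|[[i ik] [j j2]]] /=; lia. Qed.

Lemma forest_pos_inj : injective forest_pos.
Proof.
move=> [[i j]|[i j]] [[i' j']|[i' j']] /= e.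
- have [ei ej] : i = i' /\ j = j'.
    by split; apply: val_inj => /=; have := ltn_ord j; have := ltn_ord j'; lia.
  by rewrite ei ej.
- by have := ltn_ord j; have := ltn_ord i; lia.
- by have := ltn_ord j'; have := ltn_ord i'; lia.
have [ei ej] : i = i' /\ j = j'.
  by split; apply: val_inj => /=; have := ltn_ord j; have := ltn_ord j'; lia.
by rewrite ei ej.
Qed.

Lemma mem_matching_edges (T : finType) (x0 : T) s i : i < t -> size s = 2 * t ->
  [set nth x0 s (2 * i); nth x0 s (2 * i).+1] \in matching_edges t s.
Proof.
elim: t s i => // t' IH [|x [|y s]] [|i] it sz; try by move: sz => /=; lia.
  exact: mem_head.
rewrite mulnS in_cons; apply/orP; right; apply: IH => //.
by move: sz => /=; lia.
Qed.

Lemma mem_forest_edges (T : finType) (x0 : T) s : size s = 3 * k + 2 * t ->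
  [/\ forall i, i < k ->
        [set nth x0 s (3 * i); nth x0 s (3 * i).+1] \in forest_edges k t s,
      forall i, i < k ->
        [set nth x0 s (3 * i).+1; nth x0 s (3 * i).+2] \in forest_edges k t s &
      forall i, i < t ->
        [set nth x0 s (3 * k + 2 * i); nth x0 s (3 * k + 2 * i).+1] \in forest_edges k t s].
Proof.
elim: k s => [|k' IH] s sz.
  by split=> // i it; rewrite muln0 add0n mem_matching_edges.
case: s sz => [|x [|y [|z s]]] sz; try by move: sz => /=; lia.
have [|h1 h2 h3] := IH s; first by move: sz => /=; lia.
split=> [[|i]|[|i]|i] ik.
- exact: mem_head.
- by rewrite mulnS !in_cons h1 ?orbT.
- by rewrite !in_cons eqxx orbT.
- by rewrite mulnS !in_cons h2 ?orbT.
by rewrite mulnS -addnA !in_cons h3 ?orbT.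
Qed.

Lemma forest_adj_edge (T : finType) (x0 : T) s (u v : linear_forest k t) :
  size s = 3 * k + 2 * t -> adj u v ->
  [set nth x0 s (forest_pos u); nth x0 s (forest_pos v)] \in forest_edges k t s.
Proof.
move=> sz; have [h1 h2 h3] := mem_forest_edges x0 sz.
case: u v => [[i j]|[i j]] [[i' j']|[i' j']] //= /andP[/eqP/= <-].
  have := h1 _ (ltn_ord i); have := h2 _ (ltn_ord i).
  case: j j' => [[|[|[|j]]] jj] [[|[|[|j']]] jj'] //; rewrite ?addn0 ?addn1 ?addn2 // => e2 e1 _.
  - by rewrite setUC.
  - by rewrite setUC.
have := h3 _ (ltn_ord i).
case: j j' => [[|[|j]] jj] [[|[|j']] jj'] //; rewrite ?addn0 ?addn1 // => e3 _.
by rewrite setUC.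
Qed.

Lemma forest_neighbor (u : linear_forest k t) : exists v : linear_forest k t, adj u v.
Proof.
case: u => [[i [[|[|[|j]]] jj]]|[i [[|[|j]] jj]]] //.
- by exists (inl (i, @Ordinal 3 1 isT)); rewrite /= /copies_adj eqxx.
- by exists (inl (i, @Ordinal 3 0 isT)); rewrite /= /copies_adj eqxx.
- by exists (inl (i, @Ordinal 3 1 isT)); rewrite /= /copies_adj eqxx.
- by exists (inr (i, @Ordinal 2 1 isT)); rewrite /= /copies_adj eqxx.
by exists (inr (i, @Ordinal 2 0 isT)); rewrite /= /copies_adj eqxx.
Qed.

Lemma card_linear_forest : #|{: linear_forest k t}| = 3 * k + 2 * t.
Proof. by rewrite card_sum !card_prod !card_ord; lia. Qed.

End ForestCopies.

Lemma map_uniq_inj (S : eqType) (D : eqType) (c : S -> D) s :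
  uniq (map c s) -> {in s &, injective c}.
Proof.
elim: s => //= a s IH /andP[ca us] x y; rewrite !inE.
move=> /orP[/eqP->|xs] /orP[/eqP->|ys] //; last exact: IH.
- by move=> e; rewrite e map_f in ca.
by move=> e; rewrite -e map_f in ca.
Qed.

Lemma rainbow_has_rainbow (C : eqType) k t n (c : {set complete n} -> C) s :
  uniq s -> size s = 3 * k + 2 * t -> uniq (map c (forest_edges k t s)) ->
  has_rainbow (linear_forest k t) c.
Proof.
move=> us sz uc; have injc := map_uniq_inj uc.
have [x0 _|E] := pickP (fun _ : complete n => true); last first.
  have G0 (u : linear_forest k t) : False.
    by have := forest_pos_lt u; rewrite -sz; case: (s) => // x; have := E x.
  apply/existsP; exists [ffun u => False_rect _ (G0 u)].
  apply/andP; split; last by apply/dinjectiveP => e f /imsetP[_ /imsetP[[u v] _ _] _]; case: (G0 u).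
  apply/andP; split; first by apply/injectiveP => u; case: (G0 u).
  by apply/subsetP => e /imsetP[_ /imsetP[[u v] _ _] _]; case: (G0 u).
pose f : {ffun linear_forest k t -> complete n} := [ffun u => nth x0 s (forest_pos u)].
have injf : injective f.
  move=> u v; rewrite !ffunE => /eqP.
  by rewrite nth_uniq ?sz ?forest_pos_lt // => /eqP/forest_pos_inj.
have fE : {in image_edges f, forall e, e \in forest_edges k t s}.
  move=> _ /imsetP[_ /imsetP[[u v] uv ->] ->]; rewrite imsetU1 imset_set1 !ffunE.
  by apply: forest_adj_edge => //; move: uv; rewrite inE.
apply/existsP; exists f; apply/andP; split; last first.
  by apply/dinjectiveP => e e' /fE eF /fE e'F; apply: injc.
apply/andP; split; first exact/injectiveP.
apply/subsetP => e /fE /(forest_edges_pairs us); rewrite edges_complete.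
exact/subsetP/pairsS/subsetT.
Qed.

(** * The extremal colouring *)

Section Extremal.
Variable n : nat.
Hypothesis n3 : 3 <= n.

Definition last_three : {set 'I_n} := [set x : 'I_n | n - 3 <= x].

Lemma card_last_three : #|last_three| = 3.
Proof.
have -> : #|last_three| = n - #|~: last_three| by rewrite -[n in n - _]card_ord -cardsCs.
have -> : ~: last_three = [set widen_ord (leq_subr 3 n) i | i : 'I_(n - 3)].
  apply/setP => x; rewrite !inE -ltnNge; apply/idP/imsetP => [xn|[i _ ->]]; last exact: (ltn_ord i).
  by exists (Ordinal xn) => //; apply: val_inj.
rewrite card_imset ?card_ord; first by lia.
by move=> i j /(congr1 val) /= ij; apply: val_inj.
Qed.

Definition extremal_color (e : {set complete n}) : option {set complete n} :=
  if [disjoint e & last_three] then Some e else None.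

(** A rainbow copy would use a single edge meeting the last three vertices, but
    it spans all of them and has no isolated vertex. *)
Lemma extremal_no_rainbow k t : n = 3 * k + 2 * t ->
  ~~ has_rainbow (linear_forest k t) extremal_color.
Proof.
move=> nE; apply/existsP => -[f /andP[/andP[/injectiveP injf _] /dinjectiveP rb]].
have surj z : exists u, f u = z.
  have /codomP[u ->] : z \in codom f; last by exists u.
  by apply: (inj_card_onto injf); rewrite card_linear_forest card_ord nE.
have touch z : z \in last_three ->
    exists2 e, e \in image_edges f & [/\ z \in e, #|e| = 2 & extremal_color e = None].
  move=> zZ; have [u uz] := surj z; have [v uv] := forest_neighbor u.
  exists [set f u; f v].
    apply/imsetP; exists [set u; v]; last by rewrite imsetU1 imset_set1.
    by apply/imsetP; exists (u, v); rewrite // inE.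
  split; first by rewrite uz !inE eqxx.
    rewrite cards2; case: eqVneq => // /injf ee.
    by move: uv; rewrite ee adj_irr.
  rewrite /extremal_color ifN //; apply/pred0Pn; exists z.
  by rewrite /= zZ uz !inE eqxx.
have [z0 z0Z] : exists z, z \in last_three by apply/card_gt0P; rewrite card_last_three.
have [e0 e0f [_ e2 c0]] := touch z0 z0Z.
have : last_three \subset e0.
  apply/subsetP => z /touch[e ef [ze _ ce]].
  by rewrite -(rb e e0 ef e0f _) // ce c0.
by move/subset_leq_card; rewrite card_last_three e2.
Qed.

Lemma extremal_num_colors : 'C(n - 3, 2) + 1 <= num_colors extremal_color.
Proof.
have cZ : #|~: last_three| = n - 3 by rewrite cardsCs setCK card_ord card_last_three.
pose s := None :: [seq Some e | e <- enum (pairs (~: last_three))].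
have -> : 'C(n - 3, 2) + 1 = size s by rewrite /= size_map -cardE card_pairs cZ addn1.
apply: uniq_leq_size.
  rewrite /= map_inj_uniq ?enum_uniq ?andbT; last exact: Some_inj.
  by apply/mapP => -[].
move=> g; rewrite inE mem_undup => /orP[/eqP->|/mapP[e eZ ->]].
  have /card_gt1P[x [y [xZ yZ xy]]] : 1 < #|last_three| by rewrite card_last_three.
  apply/imageP; exists [set x; y]; first by rewrite edges_complete mem_pairs ?inE.
  rewrite /extremal_color ifN //; apply/pred0Pn; exists x.
  by rewrite /= xZ !inE eqxx.
move: eZ; rewrite mem_enum => eZ; apply/imageP; exists e.
  by rewrite edges_complete (subsetP (pairsS (subsetT _)) _ eZ).
rewrite /extremal_color ifT // disjoints_subset.
by move: eZ; rewrite inE => /andP[].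
Qed.

End Extremal.

(** * The anti-Ramsey number *)

Lemma num_colors_cols n (C : finType) (c : {set complete n} -> C) :
  num_colors c = #|cols c [set: 'I_n]|.
Proof.
have -> : num_colors c = #|[set g in [seq c e | e in edges (complete n)]]|.
  rewrite cardsE -(eq_card (mem_undup _)); apply/esym/card_uniqP/undup_uniq.
apply: eq_card => g; rewrite inE; apply/imageP/imsetP => -[e eE ->]; exists e => //.
  by rewrite -edges_complete.
by rewrite edges_complete.
Qed.

Lemma bin2_sub3 n : 3 <= n -> 'C(n, 2) = 'C(n - 3, 2) + 3 * n - 6.
Proof.
by case: n => [|[|[|m]]] // _; rewrite subSS subn2 !binS !bin1 !bin0 /=; lia.
Qed.

Lemma AR_linear_forest k t : 1 <= k -> 2 <= t ->
  AR (3 * k + 2 * t) (linear_forest k t) = 'C(3 * k + 2 * t - 3, 2) + 1.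
Proof.
move=> k1 t2; set n := 3 * k + 2 * t; have n7 : 7 <= n by rewrite /n; lia.
apply/eqP; rewrite eqn_leq; apply/andP; split; last first.
  apply: leq_trans (extremal_num_colors _) _; first by lia.
  by apply: leq_AR; apply: extremal_no_rainbow => //; lia.
apply/bigmax_leqP => c; apply: contraNT; rewrite -ltnNge => cW.
have W : #|[set: 'I_n]| = n by rewrite cardsT card_ord.
have [s [us _ sz [uc _]]] : rainbow c k t [set: 'I_n].
  apply: forces_rainbow => //; rewrite W.
  have : num_colors c + deficit c [set: 'I_n] = 'C(n, 2).
    by rewrite num_colors_cols card_cols W.
  rewrite (@bin2_sub3 n); last by move: n7; clear; lia.
  by move: cW n7; move: (num_colors c) (deficit c _) 'C(n - 3, 2) => a b d; lia.
exact: rainbow_has_rainbow us sz uc.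
Qed.

Import GRing.Theory.

Theorem theorem1p1 (k t n : nat) (hk : (1 <= k)%N) (ht : (2 <= t)%N)
  (hn : n = (3 * k + 2 * t)%N) :
  ((AR n (dunion (copies k (path_graph 3)) (copies t (path_graph 2))))%:R
   = 1 / 2 * (3 * k%:R + 2 * t%:R - 3) * (3 * k%:R + 2 * t%:R - 4) + 1 :> rat)%R.
Proof.
rewrite hn AR_linear_forest //.
have [m nE] : exists m, (3 * k + 2 * t = m + 4)%N.
  by exists (3 * k + 2 * t - 4)%N; lia.
rewrite nE (_ : m + 4 - 3 = m.+1)%N; last by lia.
have b : ('C(m.+1, 2)%:R * 2 = m.+1%:R * m%:R :> rat)%R.
  by rewrite -!natrM mulnC -mul_bin_diag bin1.
have e : (3 * k%:R + 2 * t%:R = m%:R + 4 :> rat)%R.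
  by have := congr1 (fun i => i%:R : rat)%R nE; rewrite (natrD _ (3 * k)) (natrD _ m) !natrM.
rewrite -natr1 in b; rewrite e natrD.
lra.
Qed.
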